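(* Let $\alpha$ be an algebraic number that is not a non-positive integer, let $K=\mathbb{Q}(\alpha)$ with ring of integers $\mathcal{O}_K$, and write $\alpha = \gamma/\beta$ with $\beta,\gamma \in \mathcal{O}_K$ coprime algebraic integers, $\beta \neq 0$. Let $P \in \mathbb{Z}[x]$ be the polynomial with $P(n) = N_{K/\mathbb{Q}}(n\beta+\gamma)$ for all integers $n$. (i) If $\liminf_{x\to\infty} \Psi_P(x,x)/x = B$, then $$\dim_{\mathbb{Q}} \operatorname{Span}_{\mathbb{Q}}\{\log(n+\alpha) : n\in\mathbb{Z},\ 0 \le n < x\} \le (1-B)x + o(x) \qquad (x\to\infty).$$ (ii) If furthermore $\mathcal{O}_K$ is a unique factorization domain and $\limsup_{x\to\infty} \Psi_P(x,x)/x = U$, then $$(1-U)x + o(x) \le \dim_{\mathbb{Q}} \operatorname{Span}_{\mathbb{Q}}\{\log(n+\alpha) : n\in\mathbb{Z},\ 0 \le n < x\} \qquad (x\to\infty).$$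
   Context: For a polynomial $P \in \mathbb{Z}[x]$ and real $x,y\ge 2$, $\Psi_P(x,y)$ denotes the number of integers in the set $\{P(n) : 1 \le n < x\}$ all of whose prime factors are less than or equal to $y$. $N_{K/\mathbb{Q}}$ is the field norm, $\log$ denotes the principal branch of the complex logarithm, and $\operatorname{Span}_{\mathbb{Q}}$ is the $\mathbb{Q}$-linear span inside $\mathbb{C}$. ''Coprime'' means $\beta$ and $\gamma$ have no common prime factor in $\mathcal{O}_K$. *)

(* Defs.v *)
From HB Require Import structures.
From mathcomp Require Import all_boot all_order all_algebra all_field.
From mathcomp Require Import complex.
From mathcomp Require Import finmap.
From mathcomp Require Import all_classical all_reals all_analysis.

Set Implicit Arguments.
Unset Strict Implicit.
Unset Printing Implicit Defensive.

Import Order.TTheory GRing.Theory Num.Theory.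
Import numFieldNormedType.Exports.

Local Open Scope classical_set_scope.
Local Open Scope ring_scope.

Section RingOfIntegers.
Variable K : fieldExtType rat.
Implicit Types x y p u : K.

Definition fieldNorm x : rat :=
  \det (passmx.mxof (vbasis {:K}) (vbasis {:K}) (amull x)).

Definition OK : set K := [set x | integralOver (intr : int -> K) x].

(* Divisibility, units, primes, irreducibles and associates are those of the
   ring [OK K], not of the field K. *)
Definition OKdvd x y : Prop := exists2 z, OK z & y = z * x.

Definition OKunit u : Prop := OK u /\ OKdvd u 1.

Definition OKprime p : Prop :=
  [/\ OK p, p != 0, ~ OKunit p &
      forall x y, OK x -> OK y -> OKdvd p (x * y) -> OKdvd p x \/ OKdvd p y].

Definition OKcoprime x y : Prop :=
  forall p, OKprime p -> ~ (OKdvd p x /\ OKdvd p y).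

Definition OKirreducible p : Prop :=
  [/\ OK p, p != 0, ~ OKunit p &
      forall x y, OK x -> OK y -> p = x * y -> OKunit x \/ OKunit y].

Definition OKassoc x y : Prop := exists2 u, OKunit u & y = u * x.

Definition OKufd : Prop :=
  (forall x, OK x -> x != 0 ->
     exists u (s : seq K),
       [/\ OKunit u, {in s, forall p, OKirreducible p} &
           x = u * \prod_(p <- s) p]) /\
  (forall u v (s t : seq K),
     OKunit u -> OKunit v ->
     {in s, forall p, OKirreducible p} -> {in t, forall p, OKirreducible p} ->
     u * \prod_(p <- s) p = v * \prod_(p <- t) p ->
     exists t' : seq K,
       [/\ perm_eq t t', size s = size t' &
           forall i, (i < size s)%N -> OKassoc s`_i t'`_i]).

End RingOfIntegers.

Arguments OK K : clear implicits.
Arguments OKufd K : clear implicits.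

Section SmoothValues.
Variable R : realType.

Definition smooth (y : R) (m : int) : Prop :=
  forall p : nat, prime p -> (p%:Z %| m)%Z -> p%:R <= y.

(* Distinct values of P are counted, not arguments n; the set is finite, so
   [fset_set] is faithful. *)
Definition Psi (P : {poly int}) (x y : R) : nat :=
  #|` fset_set [set m : int |
        (exists n : int, 1 <= n /\ n%:~R < x /\ m = P.[n]) /\ smooth y m]|%fset.

End SmoothValues.

Section ComplexLogarithm.
Variable R : realType.
Implicit Types z : R[i].

(* Principal argument, with values in ]-pi, pi] for z != 0. *)
Definition carg z : R :=
  let t := acos (complex.Re z / Normc.normc z) in if 0 <= complex.Im z then t else - t.

Definition clog z : R[i] := Complex (ln (Normc.normc z)) (carg z).

Definition cexp z : R[i] :=
  Complex (expR (complex.Re z) * cos (complex.Im z)) (expR (complex.Re z) * sin (complex.Im z)).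

Lemma normc_gt0 z : z != 0 -> 0 < Normc.normc z.
Proof.
move=> z0; rewrite lt_def; apply/andP; split; last by case: z {z0} => x y /=; rewrite sqrtr_ge0.
by apply: contra z0 => /eqP/Normc.eq0_normc ->.
Qed.

Lemma normc2 z : Normc.normc z ^+ 2 = complex.Re z ^+ 2 + complex.Im z ^+ 2.
Proof. by case: z => x y /=; rewrite sqr_sqrtr // addr_ge0 ?sqr_ge0. Qed.

Lemma Re_normc_itv z : z != 0 -> -1 <= complex.Re z / Normc.normc z <= 1.
Proof.
move=> z0; have n0 := normc_gt0 z0; rewrite -ler_norml normrM normfV (gtr0_norm n0).
rewrite ler_pdivrMr // mul1r -ler_sqr ?nnegrE ?normr_ge0 ?(ltW n0) //.
by rewrite normc2 real_normK ?num_real // lerDl sqr_ge0.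
Qed.

Lemma cos_carg z : z != 0 -> Normc.normc z * cos (carg z) = complex.Re z.
Proof.
move=> z0; have zb := Re_normc_itv z0.
have -> : cos (carg z) = complex.Re z / Normc.normc z.
  by rewrite /carg /=; case: ifP => _; rewrite ?cosN acosK ?in_itv.
by rewrite mulrC divfK // gt_eqF // normc_gt0.
Qed.

Lemma sin_carg z : z != 0 -> Normc.normc z * sin (carg z) = complex.Im z.
Proof.
move=> z0; have zb := Re_normc_itv z0; have n0 := normc_gt0 z0.
have E : Normc.normc z * sin (acos (complex.Re z / Normc.normc z)) = `|complex.Im z|.
  rewrite sin_acos // -{1}(gtr0_norm n0) -sqrtr_sqr -sqrtrM ?sqr_ge0 //.
  rewrite -sqrtr_sqr; congr Num.sqrt; rewrite mulrBr mulr1 expr_div_n.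
  by rewrite mulrCA divff ?expf_neq0 ?gt_eqF // mulr1 normc2 addrC addKr.
rewrite /carg /=; case: ifPn => [y0|].
  by rewrite E ger0_norm.
by rewrite -ltNge => y0; rewrite sinN mulrN E ltr0_norm // opprK.
Qed.

Lemma clogK z : z != 0 -> cexp (clog z) = z.
Proof.
move=> z0; rewrite /cexp /= lnK ?posrE ?normc_gt0 // cos_carg // sin_carg //.
by case: z {z0}.
Qed.

Lemma carg_itv z : z != 0 -> - pi < carg z <= pi.
Proof.
move=> z0; have zb := Re_normc_itv z0.
have t0 := acos_ge0 zb; have t1 := acos_lepi zb; have := sin_carg z0.
rewrite /carg /=; case: ifPn => [_ _|].
  by rewrite t1 andbT (lt_le_trans _ t0) // oppr_lt0 pi_gt0.
rewrite -ltNge => y0 E; apply/andP; split; last first.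
  by rewrite (le_trans _ (pi_ge0 R)) // oppr_le0.
rewrite ltrN2 lt_neqAle t1 andbT; apply/eqP => tpi.
by move: E y0; rewrite tpi sinN sinpi oppr0 mulr0 => <-; rewrite ltxx.
Qed.

End ComplexLogarithm.

Section RationalDimension.
Variable C : numFieldType.

Definition Qspan (S : set C) : set C :=
  [set z | exists n (c : 'I_n -> rat) (v : 'I_n -> C),
     (forall i, S (v i)) /\ z = \sum_i ratr (c i) * v i].

Definition Qfree d (e : 'I_d -> C) : Prop :=
  forall c : 'I_d -> rat, \sum_i ratr (c i) * e i = 0 -> forall i, c i = 0.

Definition Qbasis (V : set C) d (e : 'I_d -> C) : Prop :=
  Qfree e /\ Qspan (range e) = V.

Lemma Qspan_range d (e : 'I_d -> C) z :
  Qspan (range e) z <-> exists c : 'I_d -> rat, z = \sum_i ratr (c i) * e i.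
Proof.
split=> [[n [c [v [ev ->]]]]|[c ->]]; last first.
  by exists d, c, e; split=> // i; exists i.
have /choice[k kE] : forall i, exists k, v i = e k.
  by move=> i; have [k _ <-] := ev i; exists k.
exists (fun j => \sum_(i | k i == j) c i).
rewrite (partition_big k predT) //=; apply: eq_bigr => j _.
rewrite rmorph_sum mulr_suml; apply: eq_bigr => i /eqP <-.
by rewrite kE.
Qed.

Lemma Qbasis_leq (V : set C) d d' (e : 'I_d -> C) (e' : 'I_d' -> C) :
  Qbasis V e -> Qbasis V e' -> (d <= d')%N.
Proof.
move=> [fe se] [fe' se'].
have coord m p (f : 'I_m -> C) (g : 'I_p -> C) :
    Qspan (range f) = Qspan (range g) ->
    exists A : 'M[rat]_(m, p), forall i, f i = \sum_j ratr (A i j) * g j.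
  move=> fg; have /choice[A AE] i :
      exists c : 'I_p -> rat, f i = \sum_j ratr (c j) * g j.
    apply/Qspan_range; rewrite -fg; apply/Qspan_range.
    exists (fun j => (j == i)%:R); rewrite (bigD1 i) //= eqxx rmorph1 mul1r.
    by rewrite big1 ?addr0 // => j /negPf ->; rewrite rmorph0 mul0r.
  exists (\matrix_(i, j) A i j) => i; rewrite AE.
  by apply: eq_bigr => j _; rewrite mxE.
have [A AE] := coord _ _ e e' (etrans se (esym se')).
have [B BE] := coord _ _ e' e (etrans se' (esym se)).
suff AB1 : A *m B = 1%:M.
  by rewrite -(mxrank1 rat d) -AB1 (leq_trans (mxrankM_maxr A B)) // rank_leq_row.
apply/matrixP => i j; apply/eqP; rewrite -subr_eq0.
apply/eqP; move: j; apply: (fe (fun j => (A *m B) i j - 1%:M i j)).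
under eq_bigr do rewrite rmorphB mulrBl.
rewrite sumrB; apply/eqP; rewrite subr_eq0; apply/eqP.
transitivity (e i).
  rewrite [RHS]AE; under [RHS]eq_bigr do rewrite BE mulr_sumr.
  rewrite exchange_big; apply: eq_bigr => j _.
  rewrite mxE rmorph_sum mulr_suml; apply: eq_bigr => k _.
  by rewrite rmorphM mulrA.
rewrite (bigD1 i) //= mxE eqxx rmorph1 mul1r big1 ?addr0 // => j ji.
by rewrite mxE eq_sym (negPf ji) rmorph0 mul0r.
Qed.

(* Default value 0 if V has no finite basis. *)
Definition Qdim (V : set C) : nat :=
  xget 0%N [set d | exists e : 'I_d -> C, Qbasis V e].

Lemma QdimE (V : set C) d (e : 'I_d -> C) : Qbasis V e -> Qdim V = d.
Proof.
move=> Ve; rewrite /Qdim; case: xgetP => [m _ [e' Ve']|/(_ d)[]]; last by exists e.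
by apply/eqP; rewrite eqn_leq (Qbasis_leq Ve' Ve) (Qbasis_leq Ve Ve').
Qed.

End RationalDimension.

Definition logSpan (R : realType) (alpha : R[i]) (x : R) : set R[i] :=
  Qspan [set clog (n%:~R + alpha) | n in [set n : int | 0 <= n /\ n%:~R < x]].

(* Main.v *)
(** Write z_n = n beta + gamma, so that z_n divides P(n) in O_K.

    Upper bound. Discard a set of n < N of small density such that, for the remaining n and
    every prime p <= N, the exponent of p in P(n) is at most some k_p, with k_p = 1 for all
    large p. If n = m mod p^(k_p), then z_n / z_m = 1 + (n - m) beta / z_m is a unit at p.
    Hence a product of powers of the z_n with P(n) smooth is a unit of O_K as soon as its
    exponents sum to zero on every relevant residue class, of which there are
    O(1) + deg P * pi(N) = o(N). Adding the logarithms of the absolute values of the conjugates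
    and the arguments as further functionals, the pigeonhole principle gives exponent vectors
    whose products have bounded conjugates; as there are finitely many such algebraic integers,
    two products coincide, and the logarithms are linearly dependent. This avoids both ideals
    and the unit theorem.

    Lower bound. If P(n) has a prime factor p > x, then some prime element dividing p divides
    z_n and, by coprimality, no other z_m with m < x; so the logarithms of these n + alpha are
    independent. P is eventually injective, so counting values or arguments is the same up to
    O(1). *)
Require Import Defs.
From HB Require Import structures.
From mathcomp Require Import all_boot all_order all_algebra all_field.
From mathcomp Require Import complex finmap.
From mathcomp Require Import all_classical all_reals all_analysis.
From mathcomp Require Import zify ring lra.

Set Implicit Arguments.
Unset Strict Implicit.
Unset Printing Implicit Defensive.

Import Order.TTheory GRing.Theory Num.Theory.
Import numFieldNormedType.Exports.

(** * Counting primes *)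

Definition primorial n := \prod_(0 <= p < n.+1 | prime p) p.

Lemma prod_primes_dvd (s : seq nat) m :
  uniq s -> all prime s -> all (dvdn^~ m) s -> \prod_(p <- s) p %| m.
Proof.
elim: s => [|p s IH] /=; first by rewrite big_nil dvd1n.
case/andP=> ps us /andP[pp sp] /andP[pm sm]; rewrite big_cons Gauss_dvd.
  by rewrite pm IH.
rewrite big_seq; elim/big_ind: _ => [|x y cx cy|q qs].
- by rewrite coprimen1.
- by rewrite coprimeMr cx.
- rewrite prime_coprime // dvdn_prime2 //; last exact: (allP sp).
  by move: ps; apply: contraNneq => ->.
Qed.

(** The two middle coefficients of row 2m+1 are equal, and both occur in the expansion of
    (1+1)^(2m+1). *)
Lemma bin_mid_le m : 'C(m.*2.+1, m) <= 4 ^ m.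
Proof.
have h : 'C(m.*2.+1, m) + 'C(m.*2.+1, m.+1) <= 2 ^ m.*2.+1.
  rewrite -(addn1 1) expnDn.
  have lt1 : m < m.*2.+2 by lia.
  have lt2 : m.+1 < m.*2.+2 by lia.
  rewrite (bigD1 (Ordinal lt1)) //= (bigD1 (Ordinal lt2)) /=; last first.
    by rewrite -val_eqE /=; lia.
  by rewrite !exp1n !muln1 addnA leq_addr.
have e : 'C(m.*2.+1, m.+1) = 'C(m.*2.+1, m).
  rewrite -[RHS]bin_sub; last by lia.
  by congr ('C(_, _)); lia.
by move: h; rewrite e addnn -muln2 mulnC expnS leq_pmul2l // -mul2n expnM.
Qed.

(** Erdős's induction: for odd n = 2m+1 the primes in (m+1, 2m+1] all divide C(2m+1, m), and those
    up to m+1 are covered by induction; an even n > 2 is not prime, so it contributes nothing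
    new. *)
Lemma primorial_le n : primorial n <= 4 ^ n.
Proof.
have [k] := ubnP n; elim: k n => // k IH n nk.
have [n2|n2] := leqP n 2.
  by case: n n2 nk => [|[|[|n]]] // _ _; rewrite /primorial unlock.
case on : (odd n); last first.
  have np : ~~ prime n by apply/negP => /even_prime; rewrite on; lia.
  rewrite /primorial big_mkcond big_nat_recr //= (negPf np) muln1 -big_mkcond /=.
  apply: leq_trans (_ : primorial n.-1 <= _).
    by rewrite /primorial prednK //; lia.
  apply: leq_trans (IH _ _) _; first by lia.
  by rewrite leq_exp2l //; lia.
pose m := n./2; have nE : n = m.*2.+1 by rewrite -[LHS]odd_double_half on.
rewrite /primorial (@big_cat_nat _ _ _ m.+2) //=; last by lia.
apply: leq_trans (_ : 4 ^ m.+1 * 4 ^ m <= _); last first.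
  by rewrite -expnD leq_exp2l //; lia.
apply: leq_mul; first by apply: IH; lia.
apply: leq_trans (bin_mid_le m); rewrite -nE.
apply: dvdn_leq; first by rewrite bin_gt0; lia.
rewrite -big_filter; apply: prod_primes_dvd.
- by rewrite filter_uniq // iota_uniq.
- exact: filter_all.
apply/allP => p; rewrite mem_filter mem_index_iota => /andP[pp pb].
have : p %| n`! by rewrite dvdn_fact //; lia.
have mn : m <= n by lia.
rewrite -(bin_fact mn) Euclid_dvdM // => /orP[//|].
have np i : i < p -> ~~ (p %| i`!).
  move=> ip; apply/negP => pi.
  elim: i ip pi => [|i IHi] ip; first by rewrite fact0 dvdn1 => /eqP p1; rewrite p1 in pp.
  rewrite factS Euclid_dvdM // => /orP[/dvdn_leq|]; first by lia.
  by apply: IHi; lia.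
rewrite Euclid_dvdM // => /orP[]; apply/contraTT => _; apply: np; lia.
Qed.

Definition prime_count n := count prime (index_iota 0 n.+1).

(** Every prime at least 4^m contributes a factor at least 4^m to the primorial, which is at most
    4^n; the primes below 4^m are counted trivially. As m is free, this gives pi(n) = o(n). *)
Lemma prime_count_le n m : 0 < m -> m * prime_count n <= m * 4 ^ m + n.
Proof.
move=> m0; have [nm|mn] := ltnP n (4 ^ m).
  apply: leq_trans (leq_addr _ _); rewrite leq_pmul2l //.
  by apply: leq_trans (count_size _ _) _; rewrite size_iota subn0.
rewrite /prime_count /index_iota subn0 -(@subnKC (4 ^ m) n.+1); last by lia.
rewrite iotaD count_cat mulnDr leq_add //.
  by rewrite leq_pmul2l // (leq_trans (count_size _ _)) ?size_iota.
rewrite add0n -(@leq_exp2l 4) //; apply: leq_trans (primorial_le n).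
rewrite /primorial (@big_cat_nat _ _ _ (4 ^ m)) //=; last by lia.
have w0 : 0 < \prod_(0 <= i < 4 ^ m | prime i) i.
  by apply: prodn_cond_gt0 => p /prime_gt0.
apply: leq_trans (leq_pmull _ w0).
rewrite expnM /index_iota.
suff H k j : 4 ^ m <= j ->
    (4 ^ m) ^ count prime (iota j k) <= \prod_(i <- iota j k | prime i) i by exact: H.
elim: k j => [|k IH] j jm /=; first by rewrite big_nil expn0.
rewrite big_cons; case: ifP => pj /=; last by apply: IH; lia.
by rewrite expnS leq_mul //; apply: IH; lia.
Qed.

Lemma prime_count_small h : exists N0, forall N, N0 <= N -> h * prime_count N <= N.
Proof.
(* For m = 2(h+1) both terms m 4^m and N of the previous bound are at most N. *)
exists (2 * h.+1 * 4 ^ (2 * h.+1)) => N hN.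
have := @prime_count_le N (2 * h.+1) isT; nia.
Qed.

Lemma pfactor_dvdn_mul p k rho t y : prime p -> p ^ k %| t * y -> ~~ (p ^ rho.+1 %| y) ->
  p ^ (k - rho) %| t.
Proof.
move=> pp; case: (posnP t) => [->|t0]; first by rewrite dvdn0.
case: (posnP y) => [->|y0]; first by rewrite dvdn0.
by rewrite !pfactor_dvdn // ?muln_gt0 ?t0 // lognM //; lia.
Qed.

Local Open Scope classical_set_scope.
Local Open Scope ring_scope.

(** * Roots of polynomials modulo prime powers *)

Lemma horner_add_deriv (P : {poly int}) n t :
  exists q, P.[n + t] = P.[n] + t * (P^`().[n] + t * q).
Proof.
elim/poly_ind: P => [|p c [q E]]; first by exists 0; rewrite deriv0 !horner0; ring.
exists (p^`().[n] + q * n + t * q); rewrite derivD derivM derivX derivC !hornerE E.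
by ring.
Qed.

(** A Hensel-type separation. By the Bezout identity p^(rho+1) does not divide P'(n). With t = m -
    n, p^k divides P(m) - P(n) = t (P'(n) + t q), whose second factor is not divisible by p^(rho+1)
    either, so t absorbs the rest. *)
Lemma roots_mod_pfactor_close (P u v : {poly int}) (r : int) (p rho k : nat) (n m : int) :
  u * P + v * P^`() = r%:P -> prime p -> ~~ ((p ^ rho.+1)%N%:Z %| r)%Z -> (rho < k)%N ->
  ((p ^ k)%N%:Z %| P.[n])%Z -> ((p ^ k)%N%:Z %| P.[m])%Z ->
  ((p ^ rho.+1)%N%:Z %| m - n)%Z -> ((p ^ (k - rho))%N%:Z %| m - n)%Z.
Proof.
move=> bez pp pr rk pn pm pmn.
have [q E] := horner_add_deriv P n (m - n); rewrite addrC subrK in E.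
have pP' : ~~ ((p ^ rho.+1)%N%:Z %| P^`().[n])%Z.
  apply: contra pr => h; have := congr1 (horner^~ n) bez; rewrite !hornerE => <-.
  apply: rpredD; rewrite dvdz_mull // (dvdz_trans _ pn) //.
  by rewrite dvdzE /= dvdn_exp2l.
have : ((p ^ k)%N%:Z %| (m - n) * (P^`().[n] + (m - n) * q))%Z.
  by rewrite -(rpredDl _ pn) -E.
rewrite !dvdzE abszM => /pfactor_dvdn_mul; apply => //.
apply: contra pP' => h.
have h' : ((p ^ rho.+1)%N%:Z %| P^`().[n] + (m - n) * q)%Z by rewrite dvdzE.
by rewrite -(rpredDr _ (dvdz_mulr q pmn)).
Qed.

(** An element of [A] is determined by its label and its quotient by q, since the label fixes its
    residue mod q. *)
Lemma card_spread (N c q : nat) (A : {set 'I_N}) (kap : 'I_N -> nat) (s : seq nat) :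
  (0 < q)%N -> (size s <= c)%N -> {in A, forall n, kap n \in s} ->
  {in A &, forall n m : 'I_N, kap n = kap m -> (n = m %[mod q])%N} ->
  (#|A| <= c * (N %/ q).+1)%N.
Proof.
move=> q0 sc As close; apply: leq_trans (leq_mul sc (leqnn _)).
pose f (n : 'I_N) := (kap n, n %/ q)%N.
rewrite cardE -(size_map f) -[X in (_ <= _ * X)%N](size_iota 0) -(size_allpairs pair).
apply: uniq_leq_size.
  rewrite map_inj_in_uniq ?enum_uniq // => n m; rewrite !mem_enum => nA mA [E1 E2].
  by apply/val_inj; rewrite /= (divn_eq n q) (divn_eq m q) E2 (close n m).
move=> y /mapP[n nA ->]; rewrite mem_enum in nA.
by apply/allpairsP; exists (f n); rewrite As // mem_iota ltnS leq_div2r // ltnW.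
Qed.

Lemma size_roots_mod (P : {poly int}) (p : nat) : prime p -> ~~ (p%:Z %| lead_coef P)%Z ->
  (size [seq r <- iota 0 p | (p%:Z %| P.[r%:Z])%Z] < size P)%N.
Proof.
move=> pp pl; set s := seq.filter _ _.
have cF := pchar_Fp pp.
pose Q := map_poly (intr : int -> 'F_p) P.
have l0 : (lead_coef P)%:~R != 0 :> 'F_p by rewrite -(dvdz_pcharf cF).
have sQ : size Q = size P by rewrite size_map_poly_id0.
have Q0 : Q != 0 by rewrite -size_poly_eq0 sQ size_poly_eq0; apply: contraNneq l0 => ->; rewrite lead_coef0.
rewrite -sQ -(size_map (fun r => r%:R : 'F_p)); apply: max_poly_roots => //.
  apply/allP => y /mapP[r rs ->]; move: rs; rewrite mem_filter => /andP[pr _].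
  by rewrite /root -[_%:R]/(r%:Z%:~R) horner_map /= -(dvdz_pcharf cF).
rewrite map_inj_in_uniq ?filter_uniq ?iota_uniq // => x y.
rewrite !mem_filter !mem_iota /= !add0n => /andP[_ xp] /andP[_ yp] /(congr1 val) /=.
by rewrite !val_Fp_nat // !modn_small.
Qed.

(** Telescoping with 1/j^2 <= 1/(j-1) - 1/j. *)
Lemma sum_div_sqr (N k M : nat) : (0 < k)%N ->
  (k * (\sum_(k.+1 <= j < M) N %/ j ^ 2) <= N)%N.
Proof.
move=> k0; have [Mk|kM] := leqP M k.+1; first by rewrite big_geq // muln0.
rewrite -(subnKC (ltnW kM)); move: (M - k.+1)%N => t.
have H : ((\sum_(k.+1 <= j < k.+1 + t) N %/ j ^ 2)%N%:R : rat) <=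
    N%:R / k%:R - N%:R / (k + t)%:R.
  elim: t => [|t IH]; first by rewrite big_geq ?addn0 // subrr.
  rewrite addnS big_nat_recr ?leq_addr //= natrD.
  apply: le_trans (lerD IH _) (_ : _ + (N%:R / (k + t)%:R - N%:R / (k + t).+1%:R) <= _); last first.
    by rewrite ?addnS addrA subrK.
  rewrite addSn; set j := (k + t)%N; have j0 : (0 < j)%N by rewrite /j; lia.
  have jR : 0 < j%:R :> rat by rewrite ltr0n.
  have jS : 0 < j.+1%:R :> rat by rewrite ltr0n.
  have le1 : (N %/ j.+1 ^ 2)%:R <= N%:R / (j.+1%:R ^+ 2) :> rat.
    by rewrite ler_pdivlMr ?exprn_gt0 // -natrX -natrM ler_nat leq_trunc_div.
  apply: le_trans le1 _.
  have -> : N%:R / j%:R - N%:R / j.+1%:R = N%:R / (j%:R * j.+1%:R) :> rat.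
    by rewrite -natr1; field; rewrite natr1 !gt_eqF.
  rewrite ler_wpM2l ?ler0n // lef_pV2 ?posrE ?exprn_gt0 ?mulr_gt0 //.
  by rewrite expr2 ler_pM2r // ler_nat.
rewrite -(ler_nat rat) natrM mulrC -ler_pdivlMr ?ltr0n //.
apply: le_trans H _; rewrite gerBl divr_ge0 ?ler0n //.
Qed.

Lemma dvdz_horner_mod (P : {poly int}) (d n : nat) :
  (d%:Z %| P.[(n %% d)%N%:Z])%Z = (d%:Z %| P.[n%:Z])%Z.
Proof.
have [q E] := horner_add_deriv P (n %% d)%N%:Z (n%:Z - (n %% d)%N%:Z).
rewrite addrC subrK in E; rewrite E rpredDr // dvdz_mulr //.
by rewrite {1}(divn_eq n d) PoszD PoszM addrK dvdz_mull.
Qed.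

Lemma eqmod_dvdz_sub (q n m : nat) : (n = m %[mod q])%N <-> (q%:Z %| n%:Z - m%:Z)%Z.
Proof.
rewrite -eqz_mod_dvd !modz_nat; split => [->//|/eqP[]//].
Qed.

Definition pfactor_set (P : {poly int}) (N q : nat) : {set 'I_N} :=
  [set n : 'I_N | (q%:Z %| P.[(n : nat)%:Z])%Z].

Lemma card_union_bound (T : finType) (I : Type) (s : seq I) (F : I -> {set T}) (A : {set T}) :
  {in A, forall x, has (fun i => x \in F i) s} -> (#|A| <= \sum_(i <- s) #|F i|)%N.
Proof.
elim: s A => [|i s IH] A As.
  by rewrite big_nil leqn0 cards_eq0 -finset.subset0; apply/fintype.subsetP => x /As.
rewrite big_cons -(cardsID (F i) A) leq_add ?subset_leq_card ?finset.subsetIr //.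
apply: IH => x; rewrite inE => /andP[xF /As] /=; by rewrite (negPf xF).
Qed.

Lemma leq_sum_seq_const (I : eqType) (s : seq I) (Q : pred I) (F : I -> nat) (m c : nat) :
  (count Q s <= m)%N -> (forall i, i \in s -> Q i -> F i <= c)%N ->
  (\sum_(i <- s | Q i) F i <= m * c)%N.
Proof.
move=> sm Fc; apply: leq_trans (leq_mul sm (leqnn c)).
have -> : (count Q s * c = \sum_(i <- s | Q i) c)%N.
  by rewrite big_const_seq iter_addn addn0 mulnC.
by rewrite big_seq_cond [X in (_ <= X)%N]big_seq_cond leq_sum // => i /andP[/Fc].
Qed.

Lemma leq_mul_div_exp2 N t : (t * (N %/ 2 ^ t) <= N)%N.
Proof.
apply: leq_trans (leq_trunc_div N (2 ^ t)); rewrite mulnC leq_mul2l.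
by rewrite (ltnW (ltn_expl t _)) ?orbT.
Qed.

(** * Sieving out values divisible by high prime powers *)

Section Sieve.
Variables (P u v : {poly int}) (r : int).
Hypotheses (bez : u * P + v * P^`() = r%:P) (r0 : r != 0).

(** The separation lemma with rho = |r|: p^(|r|+1) exceeds |r|, so it cannot divide r. Each class
    mod p^(|r|+1) then meets the set in a single class mod p^(T+1), and p^(T+1) >= 2^T gives a bound
    uniform in p. *)
Lemma card_pfactor_set_small N p T : prime p ->
  (#|pfactor_set P N (p ^ (T + `|r|).+1)| <= p ^ `|r|.+1 * (N %/ 2 ^ T).+1)%N.
Proof.
move=> pp; have p1 := prime_gt1 pp.
apply: leq_trans (_ : p ^ `|r|.+1 * (N %/ p ^ T.+1).+1 <= _)%N; last first.
  rewrite leq_mul2l ltnS leq_div2l ?orbT ?expn_gt0 //.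
  apply: leq_trans (_ : p ^ T <= _)%N; first by case: (T) => // t; rewrite leq_exp2r.
  by rewrite leq_exp2l.
apply: (@card_spread _ _ _ _ (fun n : 'I_N => n %% p ^ `|r|.+1)%N (iota 0 (p ^ `|r|.+1))).
- by rewrite expn_gt0 ltnW.
- by rewrite size_iota.
- by move=> n _; rewrite mem_iota add0n ltn_mod expn_gt0 (ltnW p1).
move=> n m; rewrite !inE => nA mA /= /eqmod_dvdz_sub nm; apply/eqmod_dvdz_sub.
have -> : T.+1 = ((T + `|r|).+1 - `|r|)%N by lia.
apply: (roots_mod_pfactor_close bez) => //; rewrite ?ltnS ?leq_addl //.
rewrite dvdzE gtnNdvd ?absz_gt0 //=.
by apply: leq_trans (_ : p ^ `|r| <= _)%N; rewrite ?leq_exp2l // ltn_expl.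
Qed.

(** The separation lemma with rho = 0: each root of P mod p lifts to at most one class mod p^2. *)
Lemma card_pfactor_set_large N p : prime p -> (`|r| < p)%N ->
  ~~ (p%:Z %| lead_coef P)%Z ->
  (#|pfactor_set P N (p ^ 2)| <= size P * (N %/ p ^ 2).+1)%N.
Proof.
move=> pp rp pl; have p1 := prime_gt1 pp.
apply: (@card_spread _ _ _ _ (fun n : 'I_N => n %% p)%N
          [seq r <- iota 0 p | (p%:Z %| P.[r%:Z])%Z]).
- by rewrite expn_gt0 ltnW.
- exact/ltnW/size_roots_mod.
- move=> n; rewrite inE => nA; rewrite mem_filter dvdz_horner_mod mem_iota.
  rewrite add0n ltn_mod (prime_gt0 pp) !andbT; apply: dvdz_trans nA.
  by rewrite dvdzE /= dvdn_exp.
move=> n m; rewrite !inE => nA mA /= /eqmod_dvdz_sub nm; apply/eqmod_dvdz_sub.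
apply: (@roots_mod_pfactor_close _ _ _ _ _ 0 2 _ _ bez) => //; rewrite ?expn1 //.
by rewrite dvdzE gtnNdvd ?absz_gt0.
Qed.

(* L lists all residues mod p^K for the primes p <= k0, and for the larger primes
   the fewer than [size P] roots of P mod p; the excluded n are those with p^(K+1) | P(n),
   respectively p^2 | P(n), whose density is small by the Bezout identity. *)
Lemma sieve (h : nat) : P != 0 -> exists N0, forall N, (N0 <= N)%N ->
  exists (G : {set 'I_N}) (L : seq (nat * nat)),
  [/\ (h * #|~: G| <= N)%N, (h * size L <= N)%N &
    forall p, prime p -> (p <= N)%N -> exists k, forall n, n \in G ->
      ~~ ((p ^ k.+1)%N%:Z %| P.[(n : nat)%:Z])%Z /\
      ((p%:Z %| P.[(n : nat)%:Z])%Z -> ((p ^ k)%N, (n %% p ^ k)%N) \in L)].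
Proof.
move=> P0; pose d := size P.
(* Primes above [k0] divide neither r nor the leading coefficient. The excluded set has four
   contributions, each made at most N/(4h): the term 4hd in [k0] controls the tail of sum N/p^2, [T]
   = 4hC the small primes (using T (N/2^T) <= N), N >= T their rounding error, and pi(N) = o(N) that
   of the large primes. *)
pose k0 := (`|r| + `|lead_coef P| + 4 * h * d).+1.
pose C := (k0.+1 * k0 ^ `|r|.+1)%N.
pose T := (4 * h * C)%N; pose K := (T + `|r|)%N.
have [N1 N1P] := prime_count_small (4 * h * d).
exists (N1 + T + 2 * h * (k0.+1 * k0 ^ K))%N => N N0N.
have hpi : (4 * h * d * prime_count N <= N)%N by apply: N1P; lia.
pose kk p := if (p <= k0)%N then K else 1%N.
pose ps := [seq p <- index_iota 0 N.+1 | prime p].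
pose G := [set n : 'I_N |
  all (fun p => ~~ ((p ^ (kk p).+1)%N%:Z %| P.[(n : nat)%:Z])%Z) ps]%SET.
pose L := [seq ((p ^ K)%N, r) | p <- iota 0 k0.+1, r <- iota 0 (p ^ K)] ++
  [seq (p, r) | p <- ps, r <- [seq r <- iota 0 p | (p%:Z %| P.[r%:Z])%Z & (k0 < p)%N ]].
have bad_lead p : (k0 < p)%N -> ~~ (p%:Z %| lead_coef P)%Z.
  by move=> kp; rewrite dvdzE gtnNdvd ?absz_gt0 ?lead_coef_eq0 //; rewrite /k0 in kp; lia.
exists G, L; split.
- have le1 : (#|~: G| <= \sum_(p <- ps) #|pfactor_set P N (p ^ (kk p).+1)|)%N.
    apply: card_union_bound => n; rewrite !inE => /allPn[p pps]; rewrite negbK => pn.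
    by apply/hasP; exists p; rewrite // inE.
  have le2 : (\sum_(p <- ps | (p <= k0)%N) #|pfactor_set P N (p ^ (kk p).+1)|
      <= C * (N %/ 2 ^ T).+1)%N.
    rewrite /C -mulnA; apply: leq_sum_seq_const.
      rewrite -size_filter -[X in (_ <= X)%N](size_iota 0) uniq_leq_size //.
        by rewrite !filter_uniq // iota_uniq.
      by move=> p; rewrite mem_filter mem_iota => /andP[].
    move=> p; rewrite mem_filter => /andP[pp _] pk; rewrite /kk pk.
    apply: leq_trans (card_pfactor_set_small _ _ pp) _.
    by rewrite leq_mul2r leq_exp2r // pk orbT.
  have le3 : (\sum_(p <- ps | ~~ (p <= k0)%N) #|pfactor_set P N (p ^ (kk p).+1)|
      <= d * (\sum_(k0.+1 <= p < N.+1) N %/ p ^ 2) + d * prime_count N)%N.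
    apply: leq_trans (_ : \sum_(p <- ps | ~~ (p <= k0)) (d * (N %/ p ^ 2) + d) <= _)%N.
      rewrite big_seq_cond [X in (_ <= X)%N]big_seq_cond; apply: leq_sum => p.
      rewrite mem_filter -ltnNge => /andP[/andP[pp _] pk]; rewrite /kk (leqNgt p) pk /=.
      rewrite addnC -mulnS; apply: card_pfactor_set_large => //; last exact: bad_lead.
      by rewrite /k0 in pk; lia.
    rewrite big_split /= leq_add //; last first.
      rewrite mulnC; apply: leq_sum_seq_const => //.
      by rewrite (leq_trans (count_size _ _)) // size_filter.
    rewrite -big_distrr leq_mul2l /=; apply/orP; right.
    apply: (uniq_sub_le_big_cond leqnn (fun x y => leq_addr y x)).
    - by rewrite !filter_uniq // iota_uniq.
    - by rewrite filter_uniq // iota_uniq.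
    - by move=> p; rewrite !mem_filter !mem_index_iota; lia.
  have := sum_div_sqr N N.+1 (isT : (0 < k0)%N).
  have le4 : (T * (N %/ 2 ^ T) <= N)%N.
    exact: leq_mul_div_exp2.
  rewrite (bigID (leq^~ k0)) /= in le1.
  move: le1 le2 le3 le4; rewrite mulnS.
  set s1 := (\sum_(_ <- _ | _) _)%N; set s2 := (\sum_(_ <- _ | _) _)%N.
  set s3 := (\sum_(_ <= _ < _) _)%N; set D := (_ %/ _)%N => le1 le2 le3 le4 le5.
  have le6 : (4 * h * d * s3 <= N)%N.
    by apply: leq_trans le5; rewrite leq_mul2r /k0; lia.
  have e2 : (#|~: G| <= C + C * D + (d * s3 + d * prime_count N))%N.
    by apply: leq_trans le1 _; apply: leq_add.
  have e3 : (4 * h * C <= N)%N by apply: leq_trans N0N; rewrite -/T addnAC leq_addl.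
  move: (leq_mul (leqnn (4 * h)) e2) e3 le4 le6 hpi; rewrite /T.
  clear; move: #|~: G| => g.
  rewrite !mulnDr !mulnA; lia.
- have le1 : (\sum_(p <- iota 0 k0.+1) size (iota 0 (p ^ K)) <= k0.+1 * k0 ^ K)%N.
    apply: leq_sum_seq_const => [|p]; first by rewrite count_predT size_iota.
    by rewrite mem_iota size_iota add0n ltnS => pk _; case: (K) => // K'; rewrite leq_exp2r.
  have le2 : (\sum_(p <- ps) size [seq r <- iota 0 p | (p%:Z %| P.[r%:Z])%Z & (k0 < p)%N]
      <= prime_count N * d)%N.
    apply: leq_sum_seq_const => [|p]; first by rewrite count_predT size_filter.
    rewrite mem_filter => /andP[pp _] _; case: (ltnP k0 p) => pk.
      by under eq_filter do rewrite andbT; apply/ltnW/size_roots_mod => //; apply: bad_lead.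
    by under eq_filter do rewrite andbF; rewrite filter_pred0.
  rewrite size_cat !size_allpairs_dep !sumnE !big_map.
  move: le1 le2 hpi; set s1 := (\sum_(_ <- _) _)%N; set s2 := (\sum_(_ <- _) _)%N.
  move=> le1 le2 hpi'; have le3 : (2 * h * (k0.+1 * k0 ^ K) <= N)%N.
    by apply: leq_trans N0N; apply: leq_addl.
  move: hpi' le3 (leq_mul (leqnn (2 * h)) (leq_add le1 le2)).
  move: (k0.+1 * k0 ^ K)%N => E; clear; rewrite (mulnC (prime_count N)) !mulnDr !mulnA; lia.
- move=> p pp pN; exists (kk p) => n; rewrite inE => /allP nG.
  have pps : p \in ps by rewrite mem_filter pp mem_index_iota.
  split; first exact: nG.
  move=> pn; rewrite mem_cat; apply/orP; rewrite /kk; case: leqP => kp; [left|right].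
    apply/allpairsPdep; exists p, (n %% p ^ K)%N; split; rewrite // mem_iota //.
    by rewrite add0n /= ltn_mod expn_gt0 prime_gt0.
  apply/allpairsPdep; exists p, (n %% p)%N; rewrite expn1; split => //.
  rewrite mem_filter kp dvdz_horner_mod pn mem_iota /= add0n ltn_mod.
  exact: prime_gt0.
Qed.
End Sieve.

(** * The regular representation of a number field *)

Lemma absz_shift_lt (x : int) (T : nat) :
  `|x| <= T%:Z -> (absz (x + T%:Z)%R < (2 * T).+1)%N.
Proof. by lia. Qed.

Section RegularRepresentation.
Variable K : fieldExtType rat.
Implicit Types z w : K.

(** Multiplication matrices in a fixed basis. The size is put in the form [n.+1] so that square
    matrices form a nontrivial ring and [M] becomes a ring morphism. *)
Lemma regular_representation : exists n (M : K -> 'M[rat]_n.+1),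
  [/\ n.+1 = \dim {:K} /\ linear M, M 1 = 1, {morph M : z w / z * w} &
      forall z, fieldNorm z = \det (M z)].
Proof.
pose b := vbasis {:K}; have bb : basis_of {:K} b := vbasisP _.
pose M0 z : 'M[rat]_(\dim {:K}) := passmx.mxof b b (amull z).
have M0L : linear M0 by move=> c z w; rewrite /M0 amull_is_linear passmx.mxof_linear.
have M01 : M0 1 = 1%:M.
  by rewrite /M0 /= -(passmx.mxof1 (basis_free bb)); congr passmx.mxof; apply/lfunP => x;
     rewrite !lfunE /= mul1r.
have M0M z w : M0 (z * w) = M0 z *m M0 w.
  rewrite /M0 /= -(passmx.mxof_comp _ _ bb); congr passmx.mxof; apply/lfunP => x.
  by rewrite !lfunE /= !lfunE /= mulrA (mulrC w).
have M0d z : fieldNorm z = \det (M0 z) by [].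
have d0 : (0 < \dim {:K})%N by rewrite lt0n dimv_eq0 -subv0; apply/negP => /subvP/(_ 1 (memvf _)); rewrite memv0 oner_eq0.
move: M0 M0L M01 M0M M0d d0; move dE : (\dim _) => [//|n] M ML M1 MM Md _.
by exists n, M.
Qed.

End RegularRepresentation.

Section Representation.
Variables (K : fieldExtType rat) (n : nat) (M : K -> 'M[rat]_n.+1).
Hypotheses (dimK : n.+1 = \dim {:K}) (ML : linear M) (M1 : M 1 = 1).
Hypotheses (MM : {morph M : z w / z * w}).
Implicit Types z w : K.

HB.instance Definition _ := GRing.isSemilinear.Build rat K 'M[rat]_n.+1 _ M
  (GRing.semilinear_linear ML).
HB.instance Definition _ := GRing.isMonoidMorphism.Build K 'M[rat]_n.+1 M (conj M1 MM).

Lemma rep_in_alg (q : rat) : M q%:A = q%:M.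
Proof. by rewrite linearZ /= M1 scalemx1. Qed.

Lemma rep_inj : injective M.
Proof.
move=> z w /eqP; rewrite -subr_eq0 -rmorphB => /eqP zw.
apply/eqP; rewrite -subr_eq0; apply: contraTT isT => nz.
have := rmorph1 M; rewrite -(mulfV nz) rmorphM zw mul0r => /esym/eqP.
by rewrite oner_eq0.
Qed.

Lemma det_rep_neq0 z : z != 0 -> \det (M z) != 0.
Proof.
move=> z0; rewrite -unitfE -unitmxE; apply: (mulmx1_unit (B := M z^-1) _).1.
by rewrite -[_ *m _]MM divff.
Qed.

Lemma rep_horner (q : {poly rat}) z : M (map_poly (in_alg K) q).[z] = horner_mx (M z) q.
Proof.
elim/poly_ind: q => [|q c IH]; first by rewrite !rmorph0 horner0 rmorph0.
rewrite rmorphD rmorphM /= map_polyX map_polyC /= !hornerE rmorphD rmorphM /= IH.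
by rewrite rmorphD rmorphM /= horner_mx_X horner_mx_C rep_in_alg.
Qed.

Lemma char_poly_rep_root z : (map_poly (in_alg K) (char_poly (M z))).[z] = 0.
Proof. by apply: rep_inj; rewrite rep_horner Cayley_Hamilton rmorph0. Qed.

(** If h is monic over the integers with h(z) = 0, an eigenvector of M(z) for l is one of h(M(z)) =
    M(h(z)) = 0 for h(l), so h(l) = 0. *)
Lemma root_char_poly_Aint z (l : algC) :
  OK K z -> root (char_poly (map_mx ratr (M z))) l -> l \in Aint.
Proof.
case=> h hm hz; rewrite -eigenvalue_root_char => /eigenvalueP[v vM v0].
apply: (root_monic_Aint (p := map_poly intr h)); last first.
- by apply/polyOverP => i; rewrite coef_map /= intr_int.
- exact: monic_map.
have E (q : {poly rat}) : v *m map_mx ratr (horner_mx (M z) q) = (map_poly ratr q).[l] *: v.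
  elim/poly_ind: q => [|q c IH]; first by rewrite !rmorph0 horner0 scale0r ?map_mx0 mulmx0.
  rewrite !rmorphD !rmorphM /= horner_mx_X horner_mx_C /= mulmxDr mulmxA IH.
  by rewrite -scalemxAl vM map_scalar_mx mul_mx_scalar !map_polyX map_polyC !hornerE scalerA -scalerDl.
have := E (map_poly intr h); rewrite -rep_horner.
have -> : map_poly (in_alg K) (map_poly intr h) = map_poly intr h.
  by rewrite -map_poly_comp; apply: eq_map_poly => i; exact: (rmorph_int (in_alg K)).
rewrite (eqP hz) rmorph0 ?map_mx0 mulmx0 => /esym/eqP; rewrite scaler_eq0 (negPf v0) orbF.
rewrite -map_poly_comp (eq_map_poly (g := intr)) // => i /=; by rewrite rmorph_int.
Qed.

(** The coefficients are rational, and algebraic integers because the roots are; hence they are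
    integers. *)
Lemma char_poly_rep_int z : OK K z ->
  exists2 q : {poly int}, q \is monic & char_poly (M z) = map_poly intr q.
Proof.
move=> zO; have mc := char_poly_monic (M z).
have cA : map_poly ratr (char_poly (M z)) \is a polyOver Aint.
  rewrite map_char_poly; have [rs E] := closed_field_poly_normal (char_poly (map_mx ratr (M z)) : {poly algC}).
  rewrite E (monicP (char_poly_monic _)) scale1r big_seq; apply: rpred_prod => l lrs.
  rewrite polyOverXsubC; apply: root_char_poly_Aint zO _.
  by rewrite E rootZ ?(monicP (char_poly_monic _)) ?oner_eq0 // root_prod_XsubC.
have cZ i : (char_poly (M z))`_i \in Num.int.
  rewrite -Cint_rat; apply: Cint_rat_Aint; first exact: Crat_rat.
  by move/polyOverP/(_ i): cA; rewrite coef_map.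
exists (map_poly Num.floor (char_poly (M z))); last first.
  by rewrite floorpK //; apply/polyOverP.
apply/monicP; apply: (@intr_inj rat); rewrite -(lead_coef_map_inj (f := intr : int -> rat)) //; last exact: intr_inj.
by rewrite floorpK; [rewrite (monicP mc)|apply/polyOverP].
Qed.

Lemma OK_int (m : int) : OK K m%:~R.
Proof. exact: (integral_id (intr : {rmorphism int -> K})). Qed.

Lemma OK_add z w : OK K z -> OK K w -> OK K (z + w).
Proof. exact: (integral_add (RtoK := intr : {rmorphism int -> K})). Qed.

Lemma OK_mul z w : OK K z -> OK K w -> OK K (z * w).
Proof. exact: (integral_mul (RtoK := intr : {rmorphism int -> K})). Qed.

Lemma OK_opp z : OK K z -> OK K (- z).
Proof. exact: (integral_opp (RtoK := intr : {rmorphism int -> K})). Qed.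

Lemma OK_horner (q : {poly int}) z : OK K z -> OK K (map_poly intr q).[z].
Proof.
move=> zO; elim/poly_ind: q => [|q c IH].
  by rewrite map_poly0 horner0; apply: (OK_int 0).
rewrite rmorphD rmorphM /= map_polyX map_polyC /= !hornerE.
by apply: OK_add (OK_int c); apply: OK_mul.
Qed.

(** By Cayley-Hamilton z divides the constant coefficient of its characteristic polynomial, with a
    cofactor that is an integral polynomial in z; up to sign that coefficient is the norm. *)
Lemma norm_cofactor z : OK K z ->
  exists m : int, \det (M z) = m%:~R /\ exists2 w, OK K w & z * w = m%:~R.
Proof.
move=> zO; have [q qm qE] := char_poly_rep_int zO.
have dE : \det (M z) = ((-1) ^+ n.+1 * q`_0)%:~R.
  rewrite rmorphM /= rmorphXn rmorphN1 -(coef_map (intr : int -> rat)) -qE.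
  by rewrite char_poly_det mulrA -signr_odd -expr2 sqrr_sign mul1r.
exists ((-1) ^+ n.+1 * q`_0); split => //.
pose q1 := drop_poly 1 q.
have qD : q = q1 * 'X + (q`_0)%:P.
  rewrite -[LHS](poly_take_drop 1) addrC expr1; congr (_ + _).
  by apply/polyP => -[|i]; rewrite coef_take_poly coefC.
have E : (map_poly intr q1).[z] * z = - (q`_0)%:~R.
  have := char_poly_rep_root z; rewrite qE.
  have -> : map_poly (in_alg K) (map_poly intr q) = map_poly intr q.
    by rewrite -map_poly_comp; apply: eq_map_poly => i; exact: (rmorph_int (in_alg K)).
  rewrite {1}qD rmorphD rmorphM /= map_polyX map_polyC /= !hornerE => /eqP.
  by rewrite addr_eq0 => /eqP.
exists (- (-1) ^+ n.+1 * (map_poly intr q1).[z]).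
  by apply: OK_mul (OK_horner _ zO); rewrite -(rmorph_sign intr) -rmorphN; apply: OK_int.
by rewrite mulrCA (mulrC z) E mulrNN rmorphM /= rmorph_sign.
Qed.

(** * Complex conjugates and the norm polynomial *)

Section Generator.
Variable b : K.
Hypothesis b_gen : <<1; b>>%VS = fullv.

Lemma rep_gen_poly z : exists q : {poly rat}, M z = horner_mx (M b) q.
Proof.
have : z \in <<1; b>>%VS by rewrite b_gen memvf.
move=> /(@Fadjoin_polyP _ _ 1%AS)[p /polyOver1P[q ->] ->].
by exists q; rewrite rep_horner.
Qed.

(** For a generator the characteristic polynomial is the minimal polynomial, by degree, and this is
    separable in characteristic 0. *)
Lemma char_poly_gen_coprime : coprimep (char_poly (M b)) (char_poly (M b))^`().
Proof.
set p := char_poly _; pose pK := map_poly (in_alg K) p.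
have sp : size pK = n.+2 by rewrite size_map_poly size_char_poly.
have dv : minPoly 1 b %| pK.
  by apply: (@minPoly_dvdp _ _ 1%AS); [apply/polyOver1P; exists p|rewrite /root char_poly_rep_root].
have sm : size (minPoly 1 b) = n.+2.
  rewrite size_minPoly; congr _.+1; rewrite dimK -b_gen (dim_Fadjoin 1%AS) dimv1.
  by rewrite muln1.
have eqp : minPoly 1 b %= pK.
  by rewrite -dvdp_size_eqp // sm sp.
have cK : has_char0 K by move=> q; rewrite pchar_lalg; exact: pchar_num.
have := pcharf0_separable 1%AS cK b; rewrite /separable_element separable_poly.unlock.
move: eqp; rewrite eqp_monic ?monic_minPoly ?map_monic ?char_poly_monic // => /eqP ->.
by rewrite /pK deriv_map coprimep_map.
Qed.

Lemma char_poly_conj (F : fieldType) (m : nat) (V A : 'M[F]_m) :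
  V \in unitmx -> char_poly (V *m A *m invmx V) = char_poly A.
Proof.
move=> Vu; rewrite /char_poly.
have -> : char_poly_mx (V *m A *m invmx V) =
    map_mx polyC V *m char_poly_mx A *m map_mx polyC (invmx V).
  rewrite /char_poly_mx mulmxBr mulmxBl !map_mxM; congr (_ - _).
  by rewrite scalar_mxC -mulmxA -map_mxM mulmxV // map_mx1 mulmx1.
by rewrite !det_mulmx mulrAC -det_mulmx -map_mxM mulmxV // map_mx1 det1 mul1r.
Qed.

(** M(b) has distinct eigenvalues, hence is diagonalizable, and every M(z) is a polynomial in M(b).
    One change of basis [V] thus diagonalizes all M(z), and the diagonal entries are the conjugates
    of z. Multiplicativity is all that is recorded of them. *)
Lemma embeddings (C : numClosedFieldType) : exists sigma : 'I_n.+1 -> K -> C,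
  (forall j, sigma j 1 = 1 /\ {morph sigma j : z w / z * w}) /\
  forall z, map_poly ratr (char_poly (M z)) = \prod_j ('X - (sigma j z)%:P).
Proof.
pose f : 'M[rat]_n.+1 -> 'M[C]_n.+1 := map_mx ratr.
have /mxpoly.diagonalizableP[V Vu Vd] : exists2 rs : seq C, uniq rs &
    mxminpoly (f (M b)) %| \prod_(x <- rs) ('X - x%:P).
  have [rs E] := closed_field_poly_normal (char_poly (f (M b))).
  rewrite (monicP (char_poly_monic _)) scale1r in E.
  exists rs; last by rewrite -E mxminpoly_dvd_char.
  rewrite -separable_prod_XsubC -E separable_poly.unlock -map_char_poly deriv_map.
  by rewrite coprimep_map char_poly_gen_coprime.
pose B z := V *m f (M z) *m invmx V.
have Bd z : is_diag_mx (B z).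
  have [q qE] := rep_gen_poly z.
  have /diag_mxP[D DE] : is_diag_mx (B b) by rewrite /B -mxpoly.conjumx.
  have -> : B z = horner_mx (B b) (map_poly ratr q).
    by rewrite /B mxpoly.horner_mx_uconj // qE /f map_horner_mx.
  by rewrite DE horner_mx_diag diag_mx_is_diag.
have BM z w : B (z * w) = B z *m B w.
  by rewrite /B MM /f map_mxM !mulmxA mulmxKV.
exists (fun j z => B z j j); split => [j|z].
  split; first by rewrite /B M1 /f map_mx1 mulmx1 mulmxV // mxE eqxx.
  move=> z w; rewrite BM mxE (bigD1 j) //= big1 ?addr0 // => i ij.
  by move/is_diag_mxP: (Bd z) => -> ; rewrite ?mul0r // eq_sym.
rewrite map_char_poly -(char_poly_conj _ Vu) -/f char_poly_trig //.
exact/is_diag_mx_is_trig/Bd.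
Qed.

(** Since m be + ga = be (m - b), both sides agree at every natural number m by multiplicativity of
    the determinant. *)
Lemma poly_norm_char_poly (P : {poly int}) (be ga : K) :
  be != 0 -> b = - (ga / be) ->
  (forall m : int, (P.[m])%:~R = \det (M (m%:~R * be + ga))) ->
  map_poly intr P = \det (M be) *: char_poly (M b).
Proof.
move=> be0 bE PE; apply/eqP; rewrite -subr_eq0; set D := _ - _; apply: contraT => D0.
have := @max_poly_roots _ D [seq i%:R | i <- iota 0 (size D)] D0.
rewrite size_map size_iota ltnn => -> //; last first.
  by rewrite map_inj_uniq ?iota_uniq // => i j /eqP; rewrite eqr_nat => /eqP.
apply/allP => y /mapP[i _ ->]; rewrite /root /D hornerD hornerN hornerZ.
rewrite -[i%:R]/(i%:Z%:~R) horner_map /= PE.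
have -> : (i%:Z)%:~R * be + ga = be * ((i%:Z)%:~R%:A - b).
  by rewrite bE opprK mulrDr mulrCA divff // mulr1 mulrC -[_%:A]/(in_alg K _) rmorph_int.
rewrite MM det_mulmx -mulrBr mulf_eq0; apply/orP; right; rewrite subr_eq0; apply/eqP.
rewrite /char_poly -[RHS]/(horner_eval _ _) -det_map_mx; congr (\det _).
apply/matrixP => k l; rewrite linearB /= rep_in_alg !mxE /horner_eval !hornerE.
by rewrite hornerMn hornerX.
Qed.

(** P is a constant times a separable polynomial, so P and P' are coprime over the rationals;
    clearing denominators in the Bezout identity gives r. *)
Lemma poly_norm_bezout (P : {poly int}) (be ga : K) :
  be != 0 -> b = - (ga / be) ->
  (forall m : int, (P.[m])%:~R = \det (M (m%:~R * be + ga))) ->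
  exists u v (r : int), r != 0 /\ u * P + v * P^`() = r%:P.
Proof.
move=> be0 bE PE; have E := poly_norm_char_poly be0 bE PE.
have d0 := det_rep_neq0 be0.
have : coprimep (map_poly intr P : {poly rat}) (map_poly intr P)^`().
  rewrite E derivZ coprimepZl // coprimepZr // char_poly_gen_coprime //.
move=> /Bezout_eq1_coprimepP[[u v] /= uv].
have [U [a a0 uE]] := rat_poly_scale u; have [V [c c0 vE]] := rat_poly_scale v.
exists (c *: U), (a *: V), (a * c); split; first by rewrite mulf_neq0.
apply: (map_inj_poly (f := intr : int -> rat) (@intr_inj rat) erefl).
rewrite rmorphD !rmorphM /= !map_polyZ !map_polyC -deriv_map /=.
have a0' : a%:~R != 0 :> rat by rewrite intr_eq0.
have c0' : c%:~R != 0 :> rat by rewrite intr_eq0.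
have -> : map_poly intr U = a%:~R *: u by rewrite uE scalerA divff // scale1r.
have -> : map_poly intr V = c%:~R *: v by rewrite vE scalerA divff // scale1r.
rewrite !scalerA (mulrC c%:~R) -!scalerAl -scalerDr uv -polyCM; exact: alg_polyC.
Qed.

Section Embeddings.
Variables (C : numClosedFieldType) (sigma : 'I_n.+1 -> K -> C).
Hypothesis sigmaE : forall z, map_poly ratr (char_poly (M z)) = \prod_j ('X - (sigma j z)%:P).

Lemma coef_prod_XsubC_le (rs : seq C) i :
  `|(\prod_(r <- rs) ('X - r%:P))`_i| <= \prod_(r <- rs) (1 + `|r|).
Proof.
have ge0 (s : seq C) : 0 <= \prod_(r <- s) (1 + `|r|).
  by apply: prodr_ge0 => r _; rewrite addr_ge0.
elim: rs i => [|r rs IH] i; first by rewrite !big_nil coef1; case: eqP => _; rewrite ?normr1 ?normr0.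
rewrite !big_cons mulrBl coefB coefXM coefCM mulrDl mul1r.
apply: le_trans (ler_normB _ _) _; apply: lerD; last by rewrite normrM ler_wpM2l.
by case: eqP => _; rewrite ?normr0.
Qed.

(** Northcott's argument: bounded conjugates bound the coefficients of the integral characteristic
    polynomial, which leaves finitely many polynomials. All such z are roots of one nonzero product,
    whose size bounds their number. *)
Lemma bounded_conjugates_finite (c : nat) : exists F, forall s : seq K, uniq s ->
  {in s, forall z, OK K z /\ forall j, `|sigma j z| <= c%:R} -> (size s <= F)%N.
Proof.
pose T := (c.+1 ^ n.+1)%N.
(* The shift by T lets the natural numbers up to 2T encode the coefficients in [-T, T]. *)
pose Q (f : {ffun 'I_n.+2 -> 'I_(2 * T).+1}) : {poly K} :=
  \poly_(i < n.+2) ((f (inord i) : nat)%:R - T%:R).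
pose Big := \prod_(f | Q f != 0) Q f.
exists (size Big) => s us sP; apply/ltnW/max_poly_roots => //.
  by apply/prodf_neq0.
apply/allP => z /sP[zO zc]; have [q qm qE] := char_poly_rep_int zO.
have qT i : `|q`_i| <= T%:Z.
  rewrite -(ler_int C) intr_norm.
  have -> : (q`_i)%:~R = (map_poly ratr (char_poly (M z)))`_i :> C.
    by rewrite qE !coef_map /= ratr_int.
  rewrite sigmaE; have := coef_prod_XsubC_le [seq sigma j z | j <- index_enum 'I_n.+1] i.
  rewrite !big_map => /le_trans; apply.
  apply: (@le_trans _ _ (\prod_(j < n.+1) (c.+1)%:R)).
    by apply: ler_prod => j _; rewrite addr_ge0 //= -natr1 addrC lerD2r.
  by rewrite prodr_const card_ord -natrX.
have sq : size q = n.+2.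
  by rewrite -(size_char_poly (M z)) qE (size_map_inj_poly (@intr_inj rat)).
pose f : {ffun 'I_n.+2 -> 'I_(2 * T).+1} := [ffun i : 'I_n.+2 => inord (absz (q`_i + T%:Z))].
have fE : Q f = map_poly intr q.
  apply/polyP => i; rewrite coef_poly coef_map /=; case: ltnP => iN; last first.
    by rewrite nth_default ?sq.
  rewrite ffunE !inordK ?absz_shift_lt //.
  rewrite -[X in X - _]/((Posz _)%:~R) -[T%:R]/(T%:Z%:~R) -rmorphB; congr (_ %:~R).
  have := qT i; rewrite ler_norml => /andP[h _].
  by rewrite gez0_abs ?addrK // -lerBlDr sub0r.
have qK : map_poly intr q = map_poly (in_alg K) (char_poly (M z)).
  by rewrite qE -map_poly_comp; apply: eq_map_poly => i; apply/esym/(rmorph_int (in_alg K)).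
have f0 : Q f != 0 by rewrite fE qK -size_poly_eq0 size_map_poly size_char_poly.
have zf : root (Q f) z by rewrite /root fE qK char_poly_rep_root.
by rewrite /Big (bigD1 f) //= rootM zf.
Qed.

End Embeddings.

End Generator.
End Representation.

(** * Local integrality *)

Section LocalIntegrality.
Variable K : fieldExtType rat.
Implicit Types z w : K.

(** For a prime p this is the localization of the ring of integers at the rational integers prime to
    p, which handles all prime ideals above p at once. *)
Definition pint (p : nat) z := exists2 y : int, ~~ (p%:Z %| y)%Z & OK K (y%:~R * z).

Definition punit (p : nat) z := [/\ z != 0, pint p z & pint p z^-1].

Lemma dvdz_prime_mul p (x y : int) :
  prime p -> (p%:Z %| x * y)%Z = (p%:Z %| x)%Z || (p%:Z %| y)%Z.
Proof. by move=> pp; rewrite !dvdzE abszM Euclid_dvdM. Qed.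

Lemma pint_mul p z w : prime p -> pint p z -> pint p w -> pint p (z * w).
Proof.
move=> pp [y py yz] [x px xw]; exists (y * x); first by rewrite dvdz_prime_mul // negb_or py.
by rewrite intrM mulrACA; apply: OK_mul.
Qed.

Lemma pint_OK p z : prime p -> OK K z -> pint p z.
Proof.
move=> pp zO; exists 1; last by rewrite mul1r.
by rewrite dvdzE /= dvdn1; apply: contraTneq pp => ->.
Qed.

Lemma pint_add p z w : prime p -> pint p z -> pint p w -> pint p (z + w).
Proof.
move=> pp [y py yz] [x px xw]; exists (y * x); first by rewrite dvdz_prime_mul // negb_or py.
rewrite intrM mulrDr; apply: OK_add; last by rewrite -mulrA; apply: OK_mul xw; exact: OK_int.
by rewrite mulrAC mulrC; apply: OK_mul yz; exact: OK_int.
Qed.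

Lemma punit1 p : prime p -> punit p 1.
Proof.
move=> pp; split; rewrite ?oner_eq0 ?invr1 //; apply: pint_OK => //; exact: (OK_int K 1).
Qed.

Lemma punitM p z w : prime p -> punit p z -> punit p w -> punit p (z * w).
Proof.
move=> pp [z0 pz pz'] [w0 pw pw']; split; rewrite ?mulf_neq0 ?invfM //; exact: pint_mul.
Qed.

Lemma punitV p z : punit p z -> punit p z^-1.
Proof. by case=> z0 pz pz'; split; rewrite ?invr_eq0 ?invrK. Qed.

Lemma punit_exprz p z (c : int) : prime p -> punit p z -> punit p (z ^ c).
Proof.
move=> pp pz; have H (k : nat) : punit p (z ^+ k).
  by elim: k => [|k IH]; rewrite ?expr0 ?exprS; [apply: punit1|apply: punitM].
by case: c => k; [apply: H|rewrite NegzE -exprnN; apply/punitV/H].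
Qed.

Lemma punit_prod p (I : Type) (s : seq I) (Q : pred I) (f : I -> K) : prime p ->
  (forall i, Q i -> punit p (f i)) -> punit p (\prod_(i <- s | Q i) f i).
Proof. by move=> pp h; elim/big_ind: _ => //; [apply: punit1|move=> *; apply: punitM]. Qed.

Lemma prod_exprz (I : Type) (s : seq I) (Q : pred I) (c : I -> int) z : z != 0 ->
  \prod_(i <- s | Q i) z ^ c i = z ^ (\sum_(i <- s | Q i) c i).
Proof.
by move=> z0; apply/esym; apply: (big_morph (fun k : int => z ^ k)) => [k l|]; rewrite ?expfzDr ?expr0z.
Qed.

(** The integers m with m z integral are closed under gcd. If m > 1 has a prime factor p, the gcd
    with a y prime to p is a smaller such integer, and the descent ends at 1. *)
Lemma OK_of_pint z : (forall p, prime p -> pint p z) -> OK K z.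
Proof.
move=> h; suff H (m : nat) : (0 < m)%N -> OK K (m%:R * z) -> OK K z.
  have [y py yz] := h 2 isT.
  apply: (H `|y|%N).
    by rewrite absz_gt0; apply: contraNneq py => ->; rewrite dvdz0.
  rewrite -[_%:R]/((Posz _)%:~R) abszE; case: (ger0P y) => _ //.
  by rewrite rmorphN mulNr; apply: OK_opp.
have [k] := ubnP m; elim: k m => // k IH m mk m0 mz.
have [m1|m1] := leqP m 1; first by have -> : z = m%:R * z by rewrite (_ : m = 1%N) ?mul1r //; lia.
have pp := pdiv_prime m1; have [y py yz] := h _ pp.
have [u [v uv]] := Bezoutz m y.
apply: (IH (gcdn m `|y|)).
- suff : (gcdn m `|y| < m)%N by lia.
  rewrite ltn_neqAle dvdn_leq ?dvdn_gcdl // andbT; apply: contraNneq py => E.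
  by rewrite dvdzE (dvdn_trans (pdiv_dvd m)) // -E dvdn_gcdr.
- by rewrite gcdn_gt0 m0.
rewrite -[_%:R]/((gcdz m y)%:~R) -uv rmorphD !rmorphM /= mulrDl -!mulrA.
by apply: OK_add; apply: OK_mul => //; apply: OK_int.
Qed.

(* On a class whose exponents sum to zero, every factor may be divided by a fixed
   representative of the class. *)
Lemma punit_class_prod p (I : finType) m (kap : I -> 'I_m) (z : I -> K) (c : I -> int) :
  prime p -> (forall i, z i != 0) ->
  (forall i, ~ punit p (z i) ->
     \sum_(j | kap j == kap i) c j = 0 /\ forall j, kap j = kap i -> punit p (z j / z i)) ->
  punit p (\prod_i z i ^ c i).
Proof.
move=> pp z0 h; rewrite (partition_big kap predT) //=; apply: punit_prod => // k _.
have [[i0 [ki0 nu]]|nex] := pselect (exists i, kap i = k /\ ~ punit p (z i)); last first.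
  apply: punit_prod => // i /eqP ki; apply: punit_exprz => //.
  by apply: contrapT => nu; apply: nex; exists i.
have [s0 hj] := h _ nu; rewrite -ki0.
have -> : \prod_(i | kap i == kap i0) z i ^ c i = \prod_(i | kap i == kap i0) (z i / z i0) ^ c i.
  under [RHS]eq_bigr do rewrite expfzMl.
  by rewrite big_split /= prod_exprz ?invr_eq0 // s0 expr0z mulr1.
apply: punit_prod => // i /eqP ki; apply: punit_exprz => //; exact: hj.
Qed.
End LocalIntegrality.

Lemma dvdz_pfactor_split (p k : nat) (x : int) : (0 < p)%N -> ~~ ((p ^ k.+1)%N%:Z %| x)%Z ->
  exists j (y : int), [/\ (j <= k)%N, x = (p ^ j)%N%:Z * y & ~~ (p%:Z %| y)%Z].
Proof.
move=> p0; elim: k x => [|k IH] x; first by rewrite expn1 => px; exists 0%N, x; rewrite mul1r.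
case: (boolP (p%:Z %| x)%Z) => [/dvdzP[y ->]|px _]; last by exists 0%N, x; rewrite mul1r.
have pz : p%:Z != 0 by rewrite eqz_nat -lt0n.
rewrite expnSr PoszM dvdz_mul2r // => /IH[j [y' [jk -> py]]].
by exists j.+1, y'; rewrite ltnS jk expnSr PoszM mulrAC.
Qed.

Section LinearForms.
Variables (K : fieldExtType rat) (be ga : K) (P : {poly int}).
Hypothesis be_int : OK K be.
Let z (n : nat) : K := n%:R * be + ga.
Hypothesis cofactor : forall n, exists2 w, OK K w & z n * w = (P.[n%:Z])%:~R.
Hypothesis z_int : forall n, OK K (z n).

Lemma punit_linear p n : prime p -> z n != 0 -> ~~ (p%:Z %| P.[n%:Z])%Z -> punit p (z n).
Proof.
move=> pp z0 pP; split => //; first exact: pint_OK.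
by exists P.[n%:Z] => //; have [w wO <-] := cofactor n; rewrite mulrAC divff // mul1r.
Qed.

(** In z_n / z_m = 1 + (n - m) be / z_m, write 1 / z_m = w / P(m) with P(m) = p^j y, j <= k and p
    not dividing y: the factor p^j cancels against n - m, and y is an admissible denominator. *)
Lemma pint_linear_ratio p k n m : prime p -> z m != 0 ->
  ~~ ((p ^ k.+1)%N%:Z %| P.[m%:Z])%Z -> (n = m %[mod p ^ k])%N -> pint p (z n / z m).
Proof.
move=> pp z0 pP nm.
have -> : z n / z m = 1 + (n%:Z - m%:Z)%:~R * be / z m.
  rewrite -{1}(divff z0) -mulrDl; congr (_ / _).
  by rewrite /z rmorphB /= -!pmulrn mulrBl; ring.
apply: pint_add => //; first by apply: pint_OK => //; exact: (OK_int K 1).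
have [j [y [jk E py]]] := dvdz_pfactor_split (prime_gt0 pp) pP.
have /dvdzP[t tE] : ((p ^ j)%N%:Z %| n%:Z - m%:Z)%Z.
  by apply: dvdz_trans ((eqmod_dvdz_sub _ _ _).1 nm); rewrite dvdzE /= dvdn_exp2l.
exists y => //; have [w wO wE] := cofactor m.
have -> : y%:~R * ((n%:Z - m%:Z)%:~R * be / z m) = t%:~R * be * w.
  apply: (mulIf z0); rewrite tE -[RHS]mulrA (mulrC w) wE E !intrM.
  have -> : y%:~R * (t%:~R * (p ^ j)%N%:Z%:~R * be / z m) * z m =
     y%:~R * (t%:~R * (p ^ j)%N%:Z%:~R * be) * ((z m)^-1 * z m) by ring.
  by rewrite mulVf //; ring.
by apply: OK_mul => //; apply: OK_mul => //; apply: OK_int.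
Qed.

(** Integrality is checked prime by prime. No factor has a nonunit part at a prime above N; at p <=
    N the nonunit factors lie in classes mod p^k listed in [L], and ratios within such a class are
    units at p. *)
Lemma relation_OK N (L : seq (nat * nat)) m (nn : 'I_m -> nat) (c : 'I_m -> int) :
  (forall i, z (nn i) != 0) ->
  (forall i p, prime p -> (p%:Z %| P.[(nn i)%:Z])%Z -> (p <= N)%N) ->
  (forall p, prime p -> (p <= N)%N -> exists k, forall i,
      ~~ ((p ^ k.+1)%N%:Z %| P.[(nn i)%:Z])%Z /\
      ((p%:Z %| P.[(nn i)%:Z])%Z -> ((p ^ k)%N, (nn i %% p ^ k)%N) \in L)) ->
  (forall q r, (q, r) \in L -> \sum_(i | (nn i %% q)%N == r) c i = 0) ->
  OK K (\prod_i z (nn i) ^ c i).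
Proof.
move=> z0 sm sv rel; apply: OK_of_pint => p pp.
suff [] : punit p (\prod_i z (nn i) ^ c i) by [].
have [pN|pN] := leqP p N; last first.
  apply: punit_prod => // i _; apply/punit_exprz/punit_linear => //.
  by apply/negP => /(sm _ _ pp); rewrite leqNgt pN.
have [k kP] := sv p pp pN.
have pk i : (nn i %% p ^ k < p ^ k)%N by rewrite ltn_mod expn_gt0 prime_gt0.
apply: (@punit_class_prod _ _ _ _ (fun i => Ordinal (pk i))) => // i nu.
have pi : (p%:Z %| P.[(nn i)%:Z])%Z.
  by apply: contraPT nu => npi h; apply: h; exact: punit_linear.
split; first exact: rel ((kP i).2 pi).
move=> j [E]; have := (kP i).1; have := (kP j).1 => pj pi'.
split; first by apply: mulf_neq0; rewrite ?invr_eq0 z0.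
  exact: (pint_linear_ratio pp (z0 i) pi' E).
by rewrite invf_div; apply: (pint_linear_ratio pp (z0 j) pj (esym E)).
Qed.

End LinearForms.

(** * Rational dimension, pigeonhole and complex logarithms *)

Section FreeFamilies.
Variables (C : numFieldType) (N : nat) (v : 'I_N -> C).

Definition Qfree_on (S : {set 'I_N}) : Prop :=
  forall c : 'I_N -> rat, \sum_(i in S) ratr (c i) * v i = 0 -> forall i, i \in S -> c i = 0.

Lemma Qfree_on_sub (S T : {set 'I_N}) : T \subset S -> Qfree_on S -> Qfree_on T.
Proof.
move=> TS fS c cT i iT.
have := fS (fun j => if j \in T then c j else 0); rewrite (big_setID T) /= (finset.setIidPr TS).
rewrite [X in _ + X]big1 ?addr0 => [|j]; last first.
  by rewrite inE => /andP[/negPf -> _]; rewrite rmorph0 mul0r.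
under eq_bigr => j jT do rewrite jT.
by move=> /(_ cT i (fintype.subsetP TS _ iT)); rewrite iT.
Qed.

(** A maximal free set of indices containing [T] gives a basis of the span. In particular the span
    has a finite basis, so [Qdim] does not take its default value here. *)
Lemma Qdim_free_superset (T : {set 'I_N}) : Qfree_on T ->
  exists S : {set 'I_N}, [/\ T \subset S, Qfree_on S & Qdim (Qspan (range v)) = #|S|].
Proof.
move=> fT.
pose Q (S : {set 'I_N}) := `[<Qfree_on S>] && (T \subset S).
have QT : Q T by rewrite /Q fintype.subxx andbT; apply/asboolP.
have [S /maxsetP[/andP[/asboolP fS TS] Smax] _] := maxset_exists QT.
exists S; split => //; apply: (@QdimE _ _ _ (v \o enum_val)).
have fr : Qfree (v \o @enum_val _ (mem S)).
  move=> c cs i; pose r := enum_rank_in (enum_valP i).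
  have rK j : r (enum_val j) = j by exact: enum_valK_in.
  rewrite -(rK i); apply: (fS (c \o r)); last exact: enum_valP.
  by rewrite big_enum_val /= -[RHS]cs; apply: eq_bigr => j _; rewrite rK.
split => //; apply/seteqP; split => z.
  case=> k [c [w [wr ->]]]; exists k, c, w; split => // i.
  by have [j _ <-] := wr i; exists (enum_val j).
have spanS k : exists d : 'I_N -> rat, v k = \sum_(i in S) ratr (d i) * v i.
  have [kS|kS] := boolP (k \in S).
    exists (fun i => (i == k)%:R); rewrite (bigD1 k) //= eqxx rmorph1 mul1r.
    by rewrite big1 ?addr0 // => i /andP[_ /negPf ->]; rewrite rmorph0 mul0r.
  have : ~ Qfree_on (k |: S)%SET.
    move=> fk; have := Smax (k |: S)%SET; rewrite finset.subsetUr => E.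
    by move: kS; rewrite -E ?setU11 //; apply/andP; split;
      [apply/asboolP|apply: fintype.subset_trans TS (finset.subsetUr _ _)].
  move=> /existsNP[c /not_implyP[]]; rewrite big_setU1 //= => c0 /existsNP[i /not_implyP[ik ci]].
  have ck : c k != 0.
    apply/eqP => ck; apply: ci; move: ik c0; rewrite ck rmorph0 mul0r add0r in_setU1.
    by case/orP=> [/eqP -> //|iS] c0; apply: (fS c).
  exists (fun i => - (c i / c k)).
  have rk : ratr (c k) != 0 :> C by rewrite fmorph_eq0.
  apply: (mulfI rk); move/eqP: c0; rewrite addr_eq0 => /eqP ->.
  rewrite mulr_sumr -sumrN; apply: eq_bigr => j _.
  by rewrite rmorphN fmorph_div /= mulNr mulrN; congr (- _); rewrite mulrA mulrCA divff ?mulr1.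
have /choice[A AE] := spanS.
move=> /Qspan_range[c ->]; apply/Qspan_range.
exists (fun j => \sum_k c k * A k (enum_val j)).
rewrite -(big_enum_val (fun i => ratr (\sum_k c k * A k i) * v i)) /=.
under [RHS]eq_bigr do rewrite rmorph_sum mulr_suml.
rewrite exchange_big; apply: eq_bigr => k _ /=.
by rewrite {1}AE mulr_sumr; apply: eq_bigr => i _; rewrite rmorphM mulrA.
Qed.

End FreeFamilies.

Lemma leq_pow2r (m n e : nat) : (m <= n)%N -> (m ^ e <= n ^ e)%N.
Proof. by case: e => // e mn; rewrite leq_exp2r. Qed.

Section Pigeonhole.
Variable R : realType.

(** There are E^m exponent vectors, but their rounded values under the functionals fill only
    O(E^|J|) boxes; for large E some box receives more than F vectors. *)
Lemma pigeonhole_functionals (J : finType) (m F : nat) (l : J -> 'I_m -> R) : (#|J| < m)%N ->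
  exists E (s : seq {ffun 'I_m -> 'I_E}), [/\ uniq s, (F < size s)%N &
    forall e e' j, e \in s -> e' \in s ->
      `|\sum_i ((e i)%:Z - (e' i)%:Z)%:~R * l j i| < 1].
Proof.
move=> Jm; pose B := (Num.truncn (\sum_j \sum_i `|l j i|)).+1.
have lB j : \sum_i `|l j i| <= B%:R.
  apply: le_trans (_ : \sum_j \sum_i `|l j i| <= _).
    rewrite [leRHS](bigD1 j) //= lerDl; apply: sumr_ge0 => k _; exact: sumr_ge0.
  exact/ltW/truncnS_gt.
(* There are at most ((2B+1) E)^|J| boxes, so this choice makes F times their number less than E *
   E^|J| <= E^m. *)
pose E := (F * (2 * B).+1 ^ #|J|).+1.
pose val (e : {ffun 'I_m -> 'I_E}) j : R := \sum_i (e i : nat)%:R * l j i.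
have valb e j : `|val e j| <= (E * B)%:R.
  apply: le_trans (ler_norm_sum _ _ _) _.
  apply: le_trans (_ : E%:R * \sum_i `|l j i| <= _); last by rewrite natrM ler_wpM2l.
  rewrite mulr_sumr; apply: ler_sum => i _; rewrite normrM ler_wpM2r // normr_nat ler_nat.
  exact/ltnW.
have shift0 e j : 0 <= val e j + (E * B)%:R.
  by have := valb e j; rewrite ler_norml => /andP[h _]; lra.
pose g e j : nat := Num.truncn (val e j + (E * B)%:R).
have gb e j : (g e j < (2 * (E * B)).+1)%N.
  rewrite ltnS /g truncn_le_nat -natr1 natrM.
  have := valb e j; rewrite ler_norml => /andP[_ h]; lra.
pose Phi e := [ffun j => Ordinal (gb e j)].
have [[phi big]|small] := pselect (exists phi, (F < #|[set e | Phi e == phi]|)%N).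
  exists E, (enum [set e | Phi e == phi]); rewrite enum_uniq -cardE; split => //.
  move=> e e' j; rewrite !mem_enum !inE => /eqP <- /eqP /ffunP/(_ j); rewrite !ffunE => /(congr1 (@nat_of_ord _)) /= E1.
  have -> : \sum_i ((e i)%:Z - (e' i)%:Z)%:~R * l j i = val e j - val e' j.
    by rewrite -sumrB; apply: eq_bigr => i _; rewrite rmorphB mulrBl.
  have /andP[a1 a2] := truncn_itv (shift0 e j); have /andP[b1 b2] := truncn_itv (shift0 e' j).
  move: a1 a2 b1 b2; rewrite -/(g e j) -/(g e' j) E1 -natr1 ltr_norml => *; apply/andP; split; lra.
exfalso.
have : (E ^ m <= F * (2 * (E * B)).+1 ^ #|J|)%N.
  rewrite -[X in (X ^ m)%N]card_ord -[X in (_ ^ X)%N]card_ord -card_ffun.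
  rewrite -sum1_card (partition_big Phi predT) //=.
  apply: leq_trans (_ : \sum_(phi : {ffun J -> 'I_(2 * (E * B)).+1}) F <= _)%N.
    apply: leq_sum => phi _; rewrite sum1dep_card leqNgt; apply/negP => h; apply: small.
    exists phi; apply: leq_trans h _; apply: subset_leq_card.
    by apply/fintype.subsetP => e; rewrite !inE.
  by rewrite sum_nat_const card_ffun card_ord mulnC.
apply/negP; rewrite -ltnNge.
apply: leq_ltn_trans (_ : F * ((2 * B).+1 * E) ^ #|J| < _)%N.
  rewrite leq_mul2l; apply/orP; right; apply: leq_pow2r; nia.
rewrite expnMn mulnA; apply: leq_trans (_ : E * E ^ #|J| <= _)%N.
  by rewrite ltn_pmul2r ?expn_gt0.
by rewrite -expnS; apply: leq_pexp2l.
Qed.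
End Pigeonhole.

Section ComplexLog.
Variable R : realType.
Implicit Types z w : R[i].

Lemma cexpD z w : cexp (z + w) = cexp z * cexp w.
Proof.
case: z w => [a b] [c d]; rewrite /cexp /= expRD cosD sinD.
by apply/eqP; rewrite eq_complex /=; apply/andP; split; apply/eqP; ring.
Qed.

Lemma cexp0 : cexp (0 : R[i]) = 1.
Proof. by rewrite /cexp /= expR0 cos0 sin0 mulr1 mulr0. Qed.

Lemma cexp_mulz z (c : int) : cexp (c%:~R * z) = cexp z ^ c.
Proof.
have H (k : nat) : cexp (k%:R * z) = cexp z ^+ k.
  elim: k => [|k IH]; first by rewrite mul0r cexp0 expr0.
  by rewrite -natr1 mulrDl mul1r cexpD IH exprSr.
case: c => k; first exact: H.
rewrite NegzE rmorphN mulNr -exprnN -H /=.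
have E : cexp (- (k.+1%:R * z)) * cexp (k.+1%:R * z) = 1 by rewrite -cexpD addNr cexp0.
have n0 : cexp (k.+1%:R * z) != 0.
  by apply: contraPneq E => ->; rewrite mulr0 => /esym/eqP; rewrite oner_eq0.
by apply: (mulIf n0); rewrite mulVf.
Qed.

Lemma cexp_sum (I : finType) (f : I -> R[i]) : cexp (\sum_i f i) = \prod_i cexp (f i).
Proof. exact: (big_morph _ cexpD cexp0). Qed.

(** Half-angle formula: cos t = 1 - 2 sin(t/2)^2, and sin is positive on ]0, pi[. *)
Lemma cos_eq1_small (t : R) : cos t = 1 -> `|t| < 2 * pi -> t = 0.
Proof.
wlog t0 : t / 0 <= t.
  move=> H ct; have [t0|/ltW t0] := leP 0 t; first exact: H.
  by rewrite -normrN => h; apply/eqP; rewrite -oppr_eq0; apply/eqP/H; rewrite ?oppr_ge0 ?cosN.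
rewrite ger0_norm // => ct tp; apply/eqP; move: t0; rewrite le_eqVlt eq_sym => /orP[//|t0].
have tE : t = (t / 2) *+ 2 by lra.
have s0 : 0 < sin (t / 2) by apply: sin_gt0_pi; apply/andP; split; lra.
move: ct; rewrite tE cos_mulr2n cos2sin2 => ct.
have : 0 < sin (t / 2) ^+ 2 by rewrite exprn_gt0.
by lra.
Qed.

(** A multiplicative relation determines the sum of logarithms only up to a multiple of 2 pi i; the
    bound on the arguments forces that multiple to be zero. *)
Lemma clog_relation (I : finType) (x : I -> R[i]) (c : I -> int) :
  (forall i, x i != 0) -> \prod_i x i ^ c i = 1 ->
  `|\sum_i (c i)%:~R * carg (x i)| < 2 * pi ->
  \sum_i (c i)%:~R * clog (x i) = 0.
Proof.
move=> x0 x1 small; set S := \sum_i _.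
have imS : complex.Im S = \sum_i (c i)%:~R * carg (x i).
  rewrite (raddf_sum (@complex.Im R)); apply: eq_bigr => i _.
  by rewrite -(rmorph_int (real_complex R)) /= mul0r addr0.
have : cexp S = 1.
  by rewrite cexp_sum -[RHS]x1; apply: eq_bigr => i _; rewrite cexp_mulz clogK.
rewrite -imS in small; clear imS; case: S small => a t /= small.
rewrite /cexp /= => /eqP; rewrite eq_complex /= => /andP[/eqP ct /eqP st].
have ea : expR a = 1.
  have e2 : expR a ^+ 2 = 1.
    transitivity ((expR a * cos t) ^+ 2 + (expR a * sin t) ^+ 2).
      by rewrite !exprMn -mulrDr cos2Dsin2 mulr1.
    by rewrite ct st expr0n addr0 expr1n.
  by apply/eqP; have /eqP := e2; rewrite sqrf_eq1 => /orP[//|/eqP h]; have := expR_gt0 a; lra.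
have a0 : a = 0 by rewrite -(expRK a) ea ln1.
rewrite ea mul1r in ct; rewrite a0 (cos_eq1_small ct small) //.
Qed.
End ComplexLog.

(** * The upper bound *)

Lemma morph_exprz (K L : fieldType) (f : K -> L) (z : K) (c : int) :
  f 1 = 1 -> {morph f : x y / x * y} -> z != 0 -> f z != 0 /\ f (z ^ c) = f z ^ c.
Proof.
move=> f1 fM z0; have fz0 : f z != 0.
  by apply: contra_eq_neq f1 => fz; rewrite -(mulfV z0) fM fz mul0r eq_sym oner_eq0.
split => //; have fX k : f (z ^+ k) = f z ^+ k.
  by elim: k => [|k IH]; rewrite ?expr0 // !exprS fM IH.
case: c => k; first exact: fX.
rewrite NegzE -!exprnN -fX; apply: (mulIf (_ : f (z ^+ k.+1) != 0)).
  by rewrite fX expf_neq0.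
by rewrite -fM !mulVf ?expf_neq0 // fX expf_neq0.
Qed.

Lemma morph_prod_exprz (R : realType) (K : fieldType) (f : K -> R) (I : finType)
    (z : I -> K) (c : I -> int) :
  f 1 = 1 -> {morph f : x y / x * y} -> (forall x, 0 <= f x) -> (forall i, z i != 0) ->
  f (\prod_i z i ^ c i) = expR (\sum_i (c i)%:~R * ln (f (z i))).
Proof.
move=> f1 fM f0 z0; rewrite (big_morph f fM f1) (big_morph _ (@expRD R) (@expR0 R)).
apply: eq_bigr => i _; have [fz0 ->] := morph_exprz (c i) f1 fM (z0 i).
have fz : 0 < f (z i) by rewrite lt_def fz0 f0.
case: (c i) => k; first by rewrite -[_%:~R]/(k%:R) mulrC expRM_natr lnK.
by rewrite NegzE -exprnN rmorphN mulNr expRN /= mulrC expRM_natr lnK.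
Qed.

Lemma int_norm_lt1 (R : realType) (c : int) : `|c%:~R : R| < 1 -> c = 0.
Proof. by rewrite -intr_norm -[1]/(1%:~R) ltr_int; lia. Qed.

Section FreeBound.
Variables (R : realType) (K : fieldExtType rat) (iota : {rmorphism K -> R[i]}).
Variables (n : nat) (M : K -> 'M[rat]_n.+1).
Hypotheses (dimK : n.+1 = \dim {:K}) (ML : linear M) (M1 : M 1 = 1).
Hypotheses (MM : {morph M : z w / z * w}).
Variables (a be ga : K) (P : {poly int}).
Hypotheses (a_gen : <<1; a>>%VS = fullv) (be_int : OK K be) (ga_int : OK K ga).
Hypotheses (be0 : be != 0) (aE : a = ga / be).
Hypothesis PE : forall m : int, (P.[m])%:~R = \det (M (m%:~R * be + ga)).
Let z (k : nat) : K := k%:R * be + ga.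

Lemma linear_form_fact k : z k = be * (k%:R + a).
Proof. by rewrite aE mulrDr mulrCA divff // mulr1 mulrC. Qed.

Lemma linear_form_int k : OK K (z k).
Proof. by apply: OK_add => //; apply: OK_mul => //; exact: (OK_int K k). Qed.

Lemma linear_form_cofactor k : exists2 w, OK K w & z k * w = (P.[k%:Z])%:~R.
Proof.
have [m [mE [w wO wE]]] := norm_cofactor ML M1 MM (linear_form_int k).
exists w => //; rewrite wE; congr (_%:~R); apply: (@intr_inj rat).
by rewrite PE -mE.
Qed.

(** The right-hand side is the number of functionals: one per listed class, one per conjugate, the
    exponent sum and the argument. With more logarithms than that, more than F exponent vectors
    would give distinct integers of K with bounded conjugates. *)
Lemma free_bound N (L : seq (nat * nat)) m (nn : 'I_m -> nat) :
  (forall i, z (nn i) != 0) ->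
  (forall i p, prime p -> (p%:Z %| P.[(nn i)%:Z])%Z -> (p <= N)%N) ->
  (forall p, prime p -> (p <= N)%N -> exists k, forall i,
      ~~ ((p ^ k.+1)%N%:Z %| P.[(nn i)%:Z])%Z /\
      ((p%:Z %| P.[(nn i)%:Z])%Z -> ((p ^ k)%N, (nn i %% p ^ k)%N) \in L)) ->
  (forall c : 'I_m -> int, \sum_i (c i)%:~R * clog ((nn i)%:R + iota a) = 0 ->
     forall i, c i = 0) ->
  (m <= size L + n.+1 + 2)%N.
Proof.
move=> z0 sm sv free; rewrite leqNgt; apply/negP => mbig.
have [sigma [sigmaM sigmaE]] := embeddings dimK ML M1 MM a_gen R[i].
have x0 i : (nn i)%:R + a != 0.
  by have := z0 i; rewrite linear_form_fact mulf_eq0 negb_or => /andP[].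
pose nu j (w : K) : R := Normc.normc (sigma j w).
have nu1 j : nu j 1 = 1.
  by rewrite /nu (sigmaM j).1 Normc.normc1.
have nuM j : {morph nu j : x y / x * y}.
  by move=> x y; rewrite /nu (sigmaM j).2 Normc.normcM.
have nu0 j w : 0 <= nu j w by rewrite /nu; case: (sigma j w) => ? ?; apply: sqrtr_ge0.
(* Logarithms of conjugates will be less than 1, so the conjugates are bounded by e. *)
pose bd := (Num.truncn (expR 1 : R)).+1.
have [F FP] := bounded_conjugates_finite ML M1 MM sigmaE bd.
pose J : finType := ('I_(size L) + 'I_n.+1 + bool)%type.
pose l (j : J) (i : 'I_m) : R := match j with
  | inl (inl k) => ((nn i %% (nth (0, 0)%N L k).1)%N == (nth (0, 0)%N L k).2)%:R
  | inl (inr j) => ln (nu j (z (nn i)))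
  | inr true => 1
  (* Dividing by 2 pi turns the common bound 1 into the bound 2 pi that [clog_relation] requires. *)
  | inr false => carg ((nn i)%:R + iota a) / (2 * pi) end.
have cJ : (#|J| < m)%N by rewrite !card_sum !card_ord card_bool.
have [E [s [us Fs sP]]] := pigeonhole_functionals F l cJ.
(* Only differences of exponent vectors are controlled, so all vectors are compared with a fixed
   one. *)
have [e0 e0s] : exists e0, e0 \in s by case: s Fs {us sP} => // e0 s; exists e0; rewrite mem_head.
pose c (e e' : {ffun 'I_m -> 'I_E}) i : int := (e i)%:Z - (e' i)%:Z.
pose w e := \prod_i z (nn i) ^ c e e0 i.
have winj : {in s &, injective w}.
  move=> e e' es e's wE.
  (* An exponent sum of zero removes the factors be, so that the relation passes from the z_n to the
     n + a. *)
  have c0 : \sum_i c e e' i = 0.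
    apply: (@int_norm_lt1 R); rewrite rmorph_sum.
    by have := sP e e' (inr true) es e's; under eq_bigr do rewrite mulr1.
  have w1 : \prod_i z (nn i) ^ c e e' i = 1.
    have -> : \prod_i z (nn i) ^ c e e' i = w e / w e'.
      rewrite /w -prodfV -big_split; apply: eq_bigr => i _ /=.
      by rewrite invr_expz -expfzDr //; congr (_ ^ _); rewrite /c; lia.
    rewrite wE divff //; apply/prodf_neq0 => i _; exact: expfz_neq0.
  have y1 : \prod_i ((nn i)%:R + a) ^ c e e' i = 1.
    rewrite -[RHS]w1; under [RHS]eq_bigr do rewrite linear_form_fact expfzMl.
    by rewrite big_split /= prod_exprz // c0 expr0z mul1r.
  have ce i : c e e' i = 0.
    apply: (free (c e e')); apply: clog_relation => [j||].
    - by rewrite -(rmorph_nat iota) -rmorphD fmorph_eq0.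
    - rewrite -[RHS](rmorph1 iota) -y1 rmorph_prod; apply: eq_bigr => j _.
      by rewrite fmorphXz rmorphD rmorph_nat.
    have := sP e e' (inr false) es e's; rewrite /l.
    under eq_bigr do rewrite mulrA.
    have pi2 : 0 < 2 * pi :> R by rewrite mulr_gt0 ?pi_gt0.
    rewrite -mulr_suml normrM normfV (gtr0_norm pi2).
    by rewrite ltr_pdivrMr ?mulr_gt0 ?pi_gt0 // mul1r.
  apply/ffunP => i; apply/val_inj; have := ce i; rewrite /c /=; lia.
have := FP [seq w e | e <- s]; rewrite map_inj_in_uniq // size_map leqNgt Fs.
suff H : {in [seq w e | e <- s], forall y, OK K y /\ forall j, `|sigma j y| <= bd%:R}.
  by move=> /(_ us H).
move=> y /mapP[e es ->]; split.
  apply: (relation_OK be_int linear_form_cofactor linear_form_int z0 sm sv) => q r qrL.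
  apply: (@int_norm_lt1 R); rewrite rmorph_sum /=.
  have kL : (index (q, r) L < size L)%N by rewrite index_mem.
  have := sP e e0 (inl (inl (Ordinal kL))) es e0s; rewrite /l /= nth_index //=.
  rewrite [X in _ -> `|X| < 1]big_mkcond /=.
  by under eq_bigr do rewrite -mulr_natr; congr (`|_| < 1); apply: eq_bigr => i _;
    case: eqP; rewrite ?mulr1 ?mulr0.
move=> j.
have -> : `|sigma j (w e)| = (nu j (w e))%:C%C by rewrite normc_def /nu; case: (sigma j _).
rewrite -(rmorph_nat (real_complex R)) lecR morph_prod_exprz //.
apply: le_trans (_ : expR 1 <= _); last exact/ltW/truncnS_gt.
rewrite ler_expR; apply: le_trans (ler_norm _) _; exact/ltW/(sP e e0 (inl (inr j)) es e0s).
Qed.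
End FreeBound.

(** * From real bounds to integer counts *)

Lemma natural_below (R : realType) (x : R) : 0 < x ->
  exists N : nat, [/\ forall k : nat, (k%:R < x) = (k < N)%N, x <= N%:R & N%:R < x + 1].
Proof.
move=> x0; have c0 : 0 <= Num.ceil x by rewrite -(ler_int R) (le_trans (ltW x0)) // ceil_ge.
exists `|Num.ceil x|%N.
have cE : (`|Num.ceil x|%N)%:R = (Num.ceil x)%:~R :> R by rewrite pmulrn gez0_abs.
rewrite cE ceil_ge; split => [k|//|].
  by rewrite -ltz_nat gez0_abs // -[k%:R]/(k%:Z%:~R) ceil_gt_int.
by have := ceilB1_lt x; rewrite rmorphB /= ltrBlDr.
Qed.

Lemma logSpan_range (R : realType) (alpha : R[i]) (x : R) (N : nat) :
  (forall k : nat, (k%:R < x) = (k < N)%N) ->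
  logSpan alpha x = Qspan (range (fun i : 'I_N => clog ((i : nat)%:R + alpha))).
Proof.
move=> NE; rewrite /logSpan; congr Qspan; apply/seteqP; split => [_ [[k|k] /= [k0 kx] <-]|_ [i _ <-]].
- have kN : (k < N)%N by rewrite -NE.
  by exists (Ordinal kN).
- by [].
- by exists (Posz i); split => //=; rewrite NE.
Qed.

(** Indices start at 0 as for the logarithms, whereas [Psi] starts at 1; hence the condition that k
    be positive. *)
Definition smooth_args (R : realType) (P : {poly int}) (x : R) (N : nat) : {set 'I_N} :=
  [set k : 'I_N | (0 < k)%N & `[< smooth x P.[(k : nat)%:Z] >]].

Lemma Psi_undup (R : realType) (P : {poly int}) (x : R) (N : nat) :
  (forall k : nat, (k%:R < x) = (k < N)%N) ->
  Psi P x x = size (undup [seq P.[(k : nat)%:Z] | k : 'I_N <- enum (smooth_args P x N)]).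
Proof.
move=> NE; rewrite /Psi -card_fseq; congr (#|` _|)%fset.
rewrite -[RHS]set_fsetK; congr fset_set; apply/seteqP; split => m /=.
  case=> [[[k|k] [k1 [kx ->]]] sm] //; rewrite inE.
  have kN : (k < N)%N by rewrite -NE.
  apply/mapP; exists (Ordinal kN) => //; rewrite mem_enum inE; apply/andP; split; [exact: k1|exact/asboolP].
rewrite inE => /mapP[k]; rewrite mem_enum inE => /andP[k0 /asboolP sm] ->; split => //.
by exists (Posz k); split => //; split => //; rewrite NE.
Qed.

Lemma Psi_le_card (R : realType) (P : {poly int}) (x : R) (N : nat) :
  (forall k : nat, (k%:R < x) = (k < N)%N) -> (Psi P x x <= #|smooth_args P x N|)%N.
Proof.
by move=> NE; rewrite (Psi_undup _ NE) (leq_trans (size_undup _)) // size_map -cardE.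
Qed.

Lemma upper_arith (h N d s t c g A p l : nat) :
  (h * l <= N -> h * g <= N -> t <= l + d -> s <= t + c -> c <= N - A + g -> A <= N -> p <= A ->
   h * s + h * p <= h * N + 2 * N + h * d)%N.
Proof.
move=> hl hg tl st cA AN pA.
have : (h * (s + p) <= h * (l + d + N + g))%N by rewrite leq_mul2l; apply/orP; right; lia.
by rewrite !mulnDr; lia.
Qed.

Section UpperBound.
Variables (R : realType) (alpha : R[i]) (K : fieldExtType rat) (iota : {rmorphism K -> R[i]}).
Hypothesis alpha_nonpos : forall n : int, n <= 0 -> alpha <> n%:~R.
Variables (a be ga : K) (P : {poly int}).
Hypotheses (iota_a : iota a = alpha) (K_gen : <<1; a>>%VS = fullv).
Hypotheses (be_int : OK K be) (ga_int : OK K ga).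
Hypotheses (be0 : be != 0) (aE : a = ga / be).
Hypothesis PE : forall m : int, (P.[m])%:~R = fieldNorm (m%:~R * be + ga).

Lemma natDa_neq0 (k : nat) : k%:R + a != 0.
Proof.
apply/eqP => h; apply: (@alpha_nonpos (- k%:Z)); first by rewrite oppr_le0.
apply/eqP; rewrite rmorphN /= -pmulrn -addr_eq0 addrC -iota_a -(rmorph_nat iota) -rmorphD h.
by rewrite rmorph0.
Qed.

Lemma linear_form_neq0 (k : nat) : k%:R * be + ga != 0.
Proof.
by rewrite (linear_form_fact be0 aE) mulf_neq0 ?natDa_neq0.
Qed.

Lemma opp_gen : <<1; - a>>%VS = fullv.
Proof.
apply/eqP; rewrite eqEsubv subvf -K_gen; apply/(@FadjoinP _ _ 1%AS).
by rewrite sub1v -[X in X \in _]opprK rpredN memv_adjoin.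
Qed.

(** The term 2N pays once for the classes in [L] and once for the complement of [G]. After division
    by h it is 2N/h with h arbitrary, hence an o(N); d is independent of h. *)
Lemma upper_bound : exists d, forall h, exists N0, forall (x : R) N, (N0 <= N)%N ->
  (forall k : nat, (k%:R < x) = (k < N)%N) -> x <= N%:R ->
  (h * Qdim (logSpan alpha x) + h * Psi P x x <= h * N + 2 * N + h * d)%N.
Proof.
have [n [M [[dimK ML] M1 MM Md]]] := regular_representation K.
have PE' m : (P.[m])%:~R = \det (M (m%:~R * be + ga)) by rewrite PE Md.
have bE : - a = - (ga / be) by rewrite aE.
have [u [v [r [r0 bez]]]] := poly_norm_bezout dimK ML M1 MM opp_gen be0 bE PE'.
have P0 : P != 0.
  apply: contra_neq r0 => P0; move: bez; rewrite P0 deriv0 !mulr0 addr0 => /eqP.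
  by rewrite eq_sym polyC_eq0 => /eqP.
exists (n.+1 + 2)%N => h; have [N0 N0P] := sieve bez r0 h P0.
exists N0 => x N N0N NE xN; have [G [L [hG hL sv]]] := N0P N N0N.
rewrite (logSpan_range _ NE).
set w := fun i : 'I_N => _.
have [S [_ Sfree ->]] : exists S : {set 'I_N}, [/\ finset.set0 \subset S, Qfree_on w S &
    Qdim (Qspan (range w)) = #|S|].
  by apply: Qdim_free_superset => c _ i; rewrite inE.
(* [S] indexes a basis of the span. [free_bound] limits its part in smooth and sieved arguments; the
   remaining part is bounded by the size of the complement. *)
pose T := (S :&: (smooth_args P x N :&: G))%SET.
have TS : T \subset S by apply: subsetIl.
have Tb : (#|T| <= size L + n.+1 + 2)%N.
  have TP (i : 'I_#|T|) : enum_val i \in smooth_args P x N /\ enum_val i \in G.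
    by have := enum_valP i; rewrite !inE => /and3P[_ -> ->].
  apply: (free_bound (iota := iota) dimK ML M1 MM K_gen be_int ga_int be0 aE PE'
     (nn := fun i : 'I_#|T| => nat_of_ord (enum_val i))) => [i|i p pp pP|p pp pN|c c0 i].
  - exact: linear_form_neq0.
  - rewrite -(ler_nat R); apply: le_trans xN.
    by have [] := TP i; rewrite inE => /andP[_ /asboolP sm] _; apply: sm.
  - by have [k kP] := sv p pp pN; exists k => i; apply: kP; have [] := TP i.
  have Tfree := Qfree_on_sub TS Sfree.
  pose rk := enum_rank_in (enum_valP i).
  have rK j : rk (enum_val j) = j by exact: enum_valK_in.
  apply/eqP; rewrite -(intr_eq0 rat) -(rK i); apply/eqP.
  apply: (Tfree (fun k => (c (rk k))%:~R)); last exact: enum_valP.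
  rewrite big_enum_val /= -[RHS]c0; apply: eq_bigr => j _; rewrite rK ratr_int.
  by rewrite /w iota_a.
have Sle : (#|S| <= #|T| + #|~: (smooth_args P x N :&: G)|)%N.
  rewrite -(cardsID (smooth_args P x N :&: G) S) leq_add2l subset_leq_card //.
  by rewrite finset.setDE finset.subsetIr.
have cle : (#|~: (smooth_args P x N :&: G)| <= N - #|smooth_args P x N| + #|~: G|)%N.
  rewrite finset.setCI -[X in (X - _)%N]card_ord -(cardsC (smooth_args P x N)) addKn.
  by rewrite cardsU leq_subr.
apply: upper_arith hL hG _ Sle cle _ (Psi_le_card P NE); first by rewrite addnA.
by rewrite (leq_trans (max_card _)) // card_ord.
Qed.
End UpperBound.

(** * The lower bound *)

Section PrimeElements.
Variable K : fieldExtType rat.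
Implicit Types x y z p u : K.

Lemma OKdvd_mull x y z : OK K x -> OKdvd z y -> OKdvd z (x * y).
Proof. by move=> xO [w wO ->]; exists (x * w); [apply: OK_mul|rewrite mulrA]. Qed.

Lemma OKdvd_mulr x y z : OK K y -> OKdvd z x -> OKdvd z (x * y).
Proof. by move=> yO zx; rewrite mulrC; apply: OKdvd_mull. Qed.

Lemma OKdvd_sub x y z : OKdvd z x -> OKdvd z y -> OKdvd z (x - y).
Proof.
move=> [v vO ->] [w wO ->]; exists (v - w); last by rewrite mulrBl.
by apply: OK_add => //; apply: OK_opp.
Qed.

Lemma OKdvd_refl x : OKdvd x x.
Proof. by exists 1; rewrite ?mul1r //; exact: (OK_int K 1). Qed.

Lemma OKdvd0 x : OKdvd x 0.
Proof. by exists 0; rewrite ?mul0r //; exact: (OK_int K 0). Qed.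

Lemma OK_prod (s : seq K) : {in s, forall y, OK K y} -> OK K (\prod_(y <- s) y).
Proof.
elim: s => [|y s IH] h; first by rewrite big_nil; exact: (OK_int K 1).
rewrite big_cons; apply: OK_mul; first by apply: h; rewrite mem_head.
by apply: IH => w ws; apply: h; rewrite in_cons ws orbT.
Qed.

Lemma OKdvd_prod_mem (s : seq K) y :
  {in s, forall y, OK K y} -> y \in s -> OKdvd y (\prod_(w <- s) w).
Proof.
move=> sO ys; rewrite (big_rem y) //=; apply: OKdvd_mulr (OKdvd_refl y).
by apply: OK_prod => w /mem_rem; apply: sO.
Qed.

Hypothesis ufd : OKufd K.

(** If p w = x y, uniqueness matches p with an associate among the irreducible factors of x or of
    y. *)
Lemma OKirreducible_prime p : OKirreducible p -> OKprime p.
Proof.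
move=> pirr; have [pO p0 pnu _] := pirr; split => // x y xO yO [w wO E].
have [->|x0] := eqVneq x 0; first by left; apply: OKdvd0.
have [->|y0] := eqVneq y 0; first by right; apply: OKdvd0.
have w0 : w != 0.
  by apply: contra_eq_neq E => ->; rewrite mul0r mulf_neq0.
have [fact uniq] := ufd.
have [u [s [uU sI xE]]] := fact x xO x0.
have [v [t [vU tI yE]]] := fact y yO y0.
have [u' [r [u'U rI wE]]] := fact w wO w0.
have [||||t' [pt st assoc]] := uniq u' (u * v) (p :: r) (s ++ t) u'U.
- case: uU vU => [uO [u1 u1O u1E]] [vO [v1 v1O v1E]]; split; first exact: OK_mul.
  by exists (u1 * v1); [apply: OK_mul|rewrite mulrACA -u1E -v1E mulr1].
- by move=> q; rewrite in_cons => /orP[/eqP->|/rI].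
- by move=> q; rewrite mem_cat => /orP[/sI|/tI].
- rewrite big_cons big_cat /= mulrACA -xE -yE E wE; ring.
(* Index 0 is the position of [p] in [p :: r]. *)
have [e eU /= tE] := assoc 0%N isT.
have t't : t'`_0 \in s ++ t by rewrite (perm_mem pt) mem_nth // -st.
have pt' : OKdvd p t'`_0 by rewrite tE; exists e => //; case: eU.
have dv (l : seq K) (g h : K) : OKunit g -> {in l, forall q, OKirreducible q} ->
    h = g * \prod_(q <- l) q -> t'`_0 \in l -> OKdvd p h.
  move=> [gO _] lI -> tl; apply: OKdvd_mull => //.
  have lO : {in l, forall q, OK K q} by move=> q /lI[].
  by have [b bO ->] := OKdvd_prod_mem lO tl; apply: OKdvd_mull.
by move: t't; rewrite mem_cat => /orP[ts|tt]; [left; apply: dv xE ts|right; apply: dv yE tt].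
Qed.

Lemma OKprime_dvd_nat p (m : nat) : OKprime p -> (0 < m)%N -> OKdvd p m%:R ->
  exists2 q : nat, prime q & OKdvd p q%:R.
Proof.
move=> pp; have [k] := ubnP m; elim: k m => // k IH m mk m0 pm.
have [m1|m1] := leqP m 1.
  have E : m = 1%N by lia.
  by case: pp => pO _ nu _; case: nu; split => //; rewrite E in pm.
have qp := pdiv_prime m1; have qm := pdiv_dvd m.
move: pm; rewrite -{1}(divnK qm) natrM => pm.
have On (i : nat) : OK K i%:R by exact: (OK_int K i).
have [_ _ _ /(_ _ _ (On _) (On _) pm)[h|]] := pp; last by exists (pdiv m).
have d0 : (0 < m %/ pdiv m)%N by rewrite divn_gt0 ?pdiv_gt0 // (dvdn_leq m0 qm).
have dk : (m %/ pdiv m < k)%N by apply: leq_trans (ltn_Pdiv (prime_gt1 qp) m0) _; lia.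
exact: IH dk d0 h.
Qed.

Section Norm.
Variables (n : nat) (M : K -> 'M[rat]_n.+1).
Hypotheses (ML : linear M) (M1 : M 1 = 1).
Hypotheses (MM : {morph M : z w / z * w}).

(** The norm of pi divides that of q, which is a power of q. *)
Lemma prime_dvd_norm_prime (p : nat) (q : nat) pi (m : int) : prime p -> prime q ->
  OKdvd pi q%:R -> \det (M pi) = m%:~R -> (p%:Z %| m)%Z -> p = q.
Proof.
move=> pp qp [w wO E] mE pm.
have [k [kE _]] := norm_cofactor ML M1 MM wO.
have : \det (M q%:R) = (q%:R) ^+ n.+1.
  have -> : (q%:R : K) = (q%:R : rat)%:A by rewrite -[RHS]/(in_alg K _) rmorph_nat.
  by rewrite (rep_in_alg ML M1) det_scalar.
rewrite E MM det_mulmx kE mE -intrM -natrX -[(_ ^ _)%:R]/((Posz _)%:~R) => /intr_inj km.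
have : (p%:Z %| (q ^ n.+1)%N%:Z)%Z by rewrite -km dvdz_mull.
by rewrite dvdzE /= Euclid_dvdX // => /andP[]; rewrite dvdn_prime2 // => /eqP.
Qed.

(** Norms are multiplicative and p divides no norm of a unit, so p divides the norm of some
    irreducible factor pi of z. This pi is prime and divides its own norm, hence some rational
    prime, which must be p. *)
Lemma ufd_prime_factor (p : nat) z (m : int) : prime p -> OK K z -> z != 0 ->
  \det (M z) = m%:~R -> (p%:Z %| m)%Z -> exists pi, [/\ OKprime pi, OKdvd pi z & OKdvd pi p%:R].
Proof.
move=> pp zO z0 zm pm; have [u [s [[uO [u1 u1O u1E]] sI zE]]] := ufd.1 z zO z0.
have sO : {in s, forall q, OK K q} by move=> q /sI[].
have [pi [pis [k [kE pk]]]] : exists pi, pi \in s /\ exists k : int,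
    \det (M pi) = k%:~R /\ (p%:Z %| k)%Z.
  have [ku [kuE _]] := norm_cofactor ML M1 MM uO.
  have [ku1 [ku1E _]] := norm_cofactor ML M1 MM u1O.
  have nku : ~~ (p%:Z %| ku)%Z.
    have : \det (M 1) = 1 by rewrite M1 det1.
    rewrite u1E MM det_mulmx kuE ku1E -intrM -[1]/(1%:~R) => /intr_inj k1.
    apply/negP => h; have := dvdz_mull ku1 h.
    by rewrite k1 dvdzE /= dvdn1 => /eqP p1; rewrite p1 in pp.
  have H l (k : int) : {in l, forall q, OK K q} -> \det (M (\prod_(q <- l) q)) = k%:~R ->
      (p%:Z %| k)%Z -> exists pi, pi \in l /\ exists k : int,
    \det (M pi) = k%:~R /\ (p%:Z %| k)%Z.
    elim: l k => [|q l IH] k lO.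
      rewrite big_nil M1 det1 -[1]/(1%:~R) => /intr_inj <-.
      by rewrite dvdzE /= dvdn1 => /eqP p1; rewrite p1 in pp.
    rewrite big_cons MM det_mulmx.
    have qO : OK K q by apply: lO; rewrite mem_head.
    have lO' : {in l, forall q, OK K q} by move=> y yl; apply: lO; rewrite in_cons yl orbT.
    have [kq [kqE _]] := norm_cofactor ML M1 MM qO.
    have [kl [klE _]] := norm_cofactor ML M1 MM (OK_prod lO').
    rewrite kqE klE -intrM => /intr_inj <-; rewrite dvdz_prime_mul // => /orP[h|h].
      by exists q; rewrite mem_head; split => //; exists kq.
    by have [pi [pil piP]] := IH _ lO' klE h; exists pi; rewrite in_cons pil orbT.
  have [ks [ksE _]] := norm_cofactor ML M1 MM (OK_prod sO).
  apply: (H s ks) => //; move: zm; rewrite zE MM det_mulmx kuE ksE -intrM => /intr_inj mE.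
  by move: pm; rewrite -mE dvdz_prime_mul // (negPf nku).
have piP := OKirreducible_prime (sI _ pis).
exists pi; split => //.
  rewrite zE; apply: OKdvd_mull => //; exact: OKdvd_prod_mem.
have [piO pi0 _ _] := piP.
have [k' [k'E [w wO wE]]] := norm_cofactor ML M1 MM piO.
have k'0 : k' != 0 by rewrite -(intr_eq0 rat) -k'E det_rep_neq0.
have [q qp piq] : exists2 q : nat, prime q & OKdvd pi q%:R.
  apply: (OKprime_dvd_nat (m := `|k'|%N)) => //; first by rewrite absz_gt0.
  have := OKdvd_mulr wO (OKdvd_refl pi); rewrite wE.
  rewrite -[_%:R]/((Posz _)%:~R) abszE; case: (ger0P k') => _ //.
  by rewrite rmorphN -sub0r; apply: OKdvd_sub; apply: OKdvd0.
by rewrite (prime_dvd_norm_prime pp qp piq kE pk).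
Qed.
End Norm.

(* Units of the localization of [OK K] at the prime element pi. *)
Definition unit_at (pi y : K) :=
  exists s t, [/\ OK K s /\ OK K t, ~ OKdvd pi s, ~ OKdvd pi t & t * y = s].

Lemma unit_at_OK pi y : OKprime pi -> OK K y -> ~ OKdvd pi y -> unit_at pi y.
Proof.
move=> [piO _ nu _] yO piy; exists y, 1; split => //; first by split => //; exact: (OK_int K 1).
  by move=> h; apply: nu.
by rewrite mul1r.
Qed.

Lemma unit_atM pi x y : OKprime pi -> unit_at pi x -> unit_at pi y -> unit_at pi (x * y).
Proof.
move=> [_ _ _ pp] [s [t [[sO tO] ps pt E]]] [s' [t' [[sO' tO'] ps' pt' E']]].
exists (s * s'), (t * t'); split.
- by split; apply: OK_mul.
- by move=> /(pp _ _ sO sO')[].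
- by move=> /(pp _ _ tO tO')[].
by rewrite mulrACA E E'.
Qed.

Lemma unit_at_neq0 pi y : unit_at pi y -> y != 0.
Proof.
move=> [s [t [[sO tO] ps pt E]]]; apply/eqP => y0; apply: ps.
by rewrite -E y0 mulr0; apply: OKdvd0.
Qed.

Lemma unit_atV pi y : unit_at pi y -> unit_at pi y^-1.
Proof.
move=> yU; have y0 := unit_at_neq0 yU; move: yU => [s [t [[sO tO] ps pt E]]].
by exists t, s; split => //; rewrite -E mulfK.
Qed.

Lemma unit_at_exprz pi y (c : int) : OKprime pi -> unit_at pi y -> unit_at pi (y ^ c).
Proof.
move=> pp yU; have H k : unit_at pi (y ^+ k).
  elim: k => [|k IH]; rewrite ?expr0 ?exprS; last exact: unit_atM.
  by apply: unit_at_OK => //; [exact: (OK_int K 1)|move=> h; case: pp => piO _ nu _; apply: nu].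
by case: c => k; [apply: H|rewrite NegzE -exprnN; apply/unit_atV/H].
Qed.

(** This replaces the valuation at pi: a nonzero power of a multiple of pi is never a unit at pi. *)
Lemma unit_at_exprz_eq0 pi y (c : int) : OKprime pi -> OK K y -> OKdvd pi y ->
  unit_at pi (y ^ c) -> c = 0.
Proof.
move=> pp yO py; have H k : ~ unit_at pi (y ^+ k.+1).
  move=> [s [t [[sO tO] ps pt E]]]; apply: ps; rewrite -E; apply: OKdvd_mull => //.
  rewrite exprS; apply: OKdvd_mulr => //.
  by elim: k {E} => [|k IH]; rewrite ?expr0 ?exprS; [exact: (OK_int K 1)|apply: OK_mul].
case: c => [[|k] //|k]; first by move=> /H.
by rewrite NegzE -exprnN => /unit_atV; rewrite invrK => /H.
Qed.

End PrimeElements.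

(** * Eventual injectivity of integer polynomials *)

Lemma poly_int_eventually_pos (Q : {poly int}) : 0 < lead_coef Q ->
  exists k0 : nat, forall k : nat, (k0 <= k)%N -> 0 < Q.[k%:Z].
Proof.
elim/poly_ind: Q => [|q c IH]; first by rewrite lead_coef0 ltxx.
have [->|q0] := eqVneq q 0.
  by rewrite mul0r add0r lead_coefC => c0; exists 0%N => k _; rewrite hornerC.
rewrite lead_coefDl ?lead_coefMX => [/IH[k0 k0P]|]; last first.
  by rewrite size_mulX // (leq_ltn_trans (size_polyC_leq1 c)) // ltnS size_poly_gt0.
exists (k0 + `|c|.+1)%N => k kk; rewrite !hornerE.
have := k0P k _; rewrite (leq_trans (leq_addr _ _) kk) => /(_ isT) qk.
have : k%:Z <= q.[k%:Z] * k%:Z by rewrite ler_peMl //; lia.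
by move: (q.[_] * _) => X; lia.
Qed.

Lemma int_increasing (f : nat -> int) (k0 : nat) :
  (forall k, (k0 <= k)%N -> f k < f k.+1) ->
  forall i j, (k0 <= i)%N -> (i < j)%N -> f i < f j.
Proof.
move=> h i j ki; elim: j => // j IH; rewrite ltnS leq_eqVlt => /orP[/eqP <-|ij].
  exact: h.
by apply: lt_trans (IH ij) _; apply: h; lia.
Qed.

(** The forward difference [D] is a nonzero polynomial, so it eventually has constant sign and P is
    eventually strictly monotone. *)
Lemma poly_eventually_injective (P : {poly int}) : (1 < size P)%N ->
  exists k0 : nat, forall i j : nat, (k0 <= i)%N -> (k0 <= j)%N -> P.[i%:Z] = P.[j%:Z] -> i = j.
Proof.
move=> sP; pose D := P \Po ('X + 1) - P.
have DE (k : nat) : D.[k%:Z] = P.[k.+1%:Z] - P.[k%:Z].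
  by rewrite /D hornerD hornerN horner_comp !hornerE -addn1 PoszD.
have D0 : D != 0.
  apply/eqP => D0; have Pc (k : nat) : P.[k%:Z] = P.[0].
    by elim: k => // k <-; apply/eqP; rewrite -subr_eq0 -DE D0 horner0.
  pose Q := P - (P.[0])%:P; have Q0 : Q != 0.
    by apply: contraTneq sP => /eqP; rewrite subr_eq0 => /eqP ->; rewrite -leqNgt size_polyC_leq1.
  have := @max_poly_roots _ Q [seq i%:Z | i <- iota 0 (size Q)] Q0.
  rewrite size_map size_iota ltnn => H; suff : false by []; apply: H.
    by apply/allP => y /mapP[i _ ->]; rewrite /root /Q hornerD hornerN hornerC Pc subrr.
  by rewrite map_inj_uniq ?iota_uniq // => i j [].
have key (f : nat -> int) k0 : (forall k, (k0 <= k)%N -> f k < f k.+1) ->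
    forall i j, (k0 <= i)%N -> (k0 <= j)%N -> f i = f j -> i = j.
  move=> h i j ki kj fE; case: (ltngtP i j) => // ij.
    by have := int_increasing h ki ij; rewrite fE ltxx.
  by have := int_increasing h kj ij; rewrite fE ltxx.
have [l0|l0] := ltP 0 (lead_coef D).
  have [k0 k0P] := poly_int_eventually_pos l0; exists k0.
  by apply: key => k /k0P; rewrite DE subr_gt0.
have [|k0 k0P] := @poly_int_eventually_pos (- D).
  by rewrite lead_coefN oppr_gt0 lt_def l0 eq_sym lead_coef_eq0 D0.
exists k0 => i j ki kj E; apply: (key (fun k => - P.[k%:Z]) k0) => //; last by rewrite E.
by move=> k /k0P; rewrite hornerN DE opprB subr_gt0 ltrN2.
Qed.

(** Arguments from k0 on have distinct values; at most k0 others remain. *)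
Lemma card_smooth_args_le (R : realType) (P : {poly int}) (x : R) (N k0 : nat) :
  (forall i j : nat, (k0 <= i)%N -> (k0 <= j)%N -> P.[i%:Z] = P.[j%:Z] -> i = j) ->
  (forall k : nat, (k%:R < x) = (k < N)%N) ->
  (#|smooth_args P x N| <= Psi P x x + k0)%N.
Proof.
move=> inj NE; rewrite (Psi_undup _ NE); set S := smooth_args P x N.
pose S1 := [set k in S | (k0 <= k)%N]%SET.
rewrite -(cardsID S1 S) (finset.setIidPr _); last by apply/fintype.subsetP => k; rewrite inE => /andP[].
apply: leq_add.
  rewrite cardE -(size_map (fun k : 'I_N => P.[(k : nat)%:Z])); apply: uniq_leq_size.
    rewrite map_inj_in_uniq ?enum_uniq // => i j; rewrite !mem_enum !inE => /andP[_ ki] /andP[_ kj].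
    by move=> /(inj _ _ ki kj) /val_inj.
  move=> y /mapP[k]; rewrite mem_enum inE => /andP[kS _] ->; rewrite mem_undup.
  by apply/mapP; exists k; rewrite ?mem_enum.
rewrite -[X in (_ <= X)%N](size_iota 0) cardE -(size_map (@nat_of_ord N)); apply: uniq_leq_size.
  by rewrite map_inj_uniq ?enum_uniq //; apply: val_inj.
move=> y /mapP[k]; rewrite mem_enum !inE => /andP[h kS] ->; rewrite mem_iota.
by move: h; rewrite kS /= -ltnNge.
Qed.

Section LowerBound.
Variables (R : realType) (alpha : R[i]) (K : fieldExtType rat) (iota : {rmorphism K -> R[i]}).
Hypothesis alpha_nonpos : forall n : int, n <= 0 -> alpha <> n%:~R.
Variables (a be ga : K) (P : {poly int}).
Hypothesis iota_a : iota a = alpha.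
Hypotheses (be_int : OK K be) (ga_int : OK K ga).
Hypotheses (be0 : be != 0) (aE : a = ga / be) (cop : OKcoprime be ga).
Hypothesis PE : forall m : int, (P.[m])%:~R = fieldNorm (m%:~R * be + ga).
Hypothesis ufd : OKufd K.
Let z (k : nat) : K := k%:R * be + ga.

Lemma prime_not_dvd_beta pi k : OKprime pi -> OKdvd pi (z k) -> ~ OKdvd pi be.
Proof.
move=> pp pz pb; apply: (cop pp); split => //.
have -> : ga = z k - k%:R * be by rewrite /z addrC addKr.
by apply: OKdvd_sub => //; apply: OKdvd_mull => //; exact: (OK_int K k).
Qed.

(** Here pi divides z_k - z_j = (k - j) be but not be, hence it divides k - j. If j and k differ, k
    - j is prime to p because |k - j| < p, and Bezout makes pi a unit. *)
Lemma prime_not_dvd_others (pi : K) (p N j k : nat) : OKprime pi -> prime p ->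
  (N <= p)%N -> (j < N)%N -> (k < N)%N -> OKdvd pi p%:R -> OKdvd pi (z k) -> OKdvd pi (z j) ->
  j = k.
Proof.
move=> pip pp Np jN kN dp dk dj.
have E : z k - z j = (k%:Z - j%:Z)%:~R * be by rewrite /z rmorphB /= -!pmulrn; ring.
have [_ _ nu Hp] := pip; have := OKdvd_sub dk dj; rewrite E => /(Hp _ _ (OK_int K _) be_int)[]; last first.
  by move=> h; case: (prime_not_dvd_beta pip dk h).
move=> dt; case: (boolP (p%:Z %| k%:Z - j%:Z)%Z) => [|nd].
  case: (ltngtP j k) => // jk; rewrite dvdzE => /dvdn_leq h; exfalso; have := h _; lia.
exfalso; have [u [v uv]] := Bezoutz p (k%:Z - j%:Z).
have cp : gcdz p (k%:Z - j%:Z) = 1.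
  by apply/eqP; rewrite -[_ == _]/(coprimez _ _) coprimezE prime_coprime // -dvdzE.
apply: nu; split; first by case: pip.
have -> : (1 : K) = u%:~R * p%:R - (- v)%:~R * (k%:Z - j%:Z)%:~R.
  rewrite intrN mulNr opprK.
  by have := congr1 (intr : int -> K) uv; rewrite cp rmorphD !rmorphM /= => /esym.
by apply: OKdvd_sub; apply: OKdvd_mull => //; apply: OK_int.
Qed.

(** Exponentiating a relation with cleared denominators makes a product of powers of the z_i equal
    to a power of be. At the private prime of z_k everything except z_k is a unit, so the exponent
    of z_k vanishes. *)
Lemma Qfree_of_private_primes (N : nat) (T : {set 'I_N}) (w : 'I_N -> R[i]) :
  (forall i : 'I_N, w i = clog ((i : nat)%:R + alpha)) ->
  (forall k, k \in T -> exists pi, [/\ OKprime pi, OKdvd pi (z k) &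
     forall j : 'I_N, OKdvd pi (z j) -> j = k]) ->
  Qfree_on w T.
Proof.
move=> wE priv c c0 k kT.
pose D : rat := \prod_i (denq (c i))%:~R.
have D0 : D != 0 by apply/prodf_neq0 => i _; rewrite intr_eq0 denq_neq0.
have /choice[e eE] (i : 'I_N) : exists m : int, D * c i = m%:~R.
  exists (numq (c i) * \prod_(j | j != i) denq (c j)).
  by rewrite /D (bigD1 i) //= rmorphM rmorph_prod /= -[X in _ * X](divq_num_den (c i)) mulrC
     mulrA divfK ?intr_eq0 ?denq_neq0.
suff ek : e k = 0.
  by have := eE k; rewrite ek => /eqP; rewrite mulf_eq0 (negPf D0) => /eqP.
have z0 (i : nat) : z i != 0 by exact: (linear_form_neq0 alpha_nonpos iota_a be0 aE).
have x0 (i : nat) : i%:R + a != 0 by exact: (natDa_neq0 alpha_nonpos iota_a).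
have rel : \sum_(i in T) (e i)%:~R * w i = 0.
  transitivity (ratr D * \sum_(i in T) ratr (c i) * w i); last by rewrite c0 mulr0.
  rewrite mulr_sumr; apply: eq_bigr => i _.
  by rewrite mulrA -rmorphM /= eE ratr_int.
have xrel : \prod_(i in T) ((i : nat)%:R + a) ^ e i = 1.
  apply: (fmorph_inj iota); rewrite rmorph1 -(@cexp0 R) -rel.
  rewrite (big_morph _ (@cexpD R) (@cexp0 R)) rmorph_prod; apply: eq_bigr => i _.
  rewrite cexp_mulz fmorphXz wE rmorphD /= rmorph_nat iota_a clogK //.
  by rewrite -iota_a -(rmorph_nat iota) -rmorphD fmorph_eq0.
have zrel : \prod_(i in T) z i ^ e i = be ^ \sum_(i in T) e i.
  have -> : \prod_(i in T) z i ^ e i =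
      \prod_(i in T) be ^ e i * \prod_(i in T) ((i : nat)%:R + a) ^ e i.
    by rewrite -big_split; apply: eq_bigr => i _ /=; rewrite /z (linear_form_fact be0 aE) expfzMl.
  by rewrite xrel mulr1 prod_exprz.
have [pi [pip piz pio]] := priv k kT.
have zO (i : nat) : OK K (z i) by exact: linear_form_int.
apply: (unit_at_exprz_eq0 pip (zO k) piz).
rewrite (bigD1 k) //= in zrel.
set X := \prod_(i in T | _) _ in zrel.
have XU : unit_at pi X.
  rewrite /X; elim/big_ind: _ => [|x y|i /andP[iT ik]].
  - by apply: (unit_at_exprz 0 pip (y := be)); apply: unit_at_OK => //; apply: prime_not_dvd_beta piz.
  - exact: unit_atM.
  apply: unit_at_exprz => //; apply: unit_at_OK => // /pio E; by rewrite E eqxx in ik.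
have -> : z k ^ e k = be ^ (\sum_(i in T) e i) * X^-1.
  by rewrite -zrel mulfK // (unit_at_neq0 XU).
apply: unit_atM => //; last exact: unit_atV.
by apply: unit_at_exprz => //; apply: unit_at_OK => //; apply: prime_not_dvd_beta piz.
Qed.

Lemma lower_bound : exists d, forall (x : R) N, (forall k : nat, (k%:R < x) = (k < N)%N) ->
  x <= N%:R -> (N <= Qdim (logSpan alpha x) + Psi P x x + d)%N.
Proof.
have [n [M [[dimK ML] M1 MM Md]]] := regular_representation K.
have PE' m : (P.[m])%:~R = \det (M (m%:~R * be + ga)) by rewrite PE Md.
have bE : - a = - (ga / be) by rewrite aE.
have d0 : \det (M be) != 0 by exact: det_rep_neq0.
have sP : (1 < size P)%N.
  have := poly_norm_char_poly ML M1 MM be0 bE PE' => /(congr1 (@size rat \o @polyseq rat)) /=.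
  by rewrite (size_map_inj_poly (@intr_inj rat)) // size_scale // size_char_poly => ->.
have [k0 inj] := poly_eventually_injective sP.
exists k0.+1 => x N NE xN; rewrite (logSpan_range _ NE); set w := fun i : 'I_N => _.
pose T := [set k : 'I_N | `[< ~ smooth x P.[(k : nat)%:Z] >]]%SET.
have Tfree : Qfree_on w T.
  apply: Qfree_of_private_primes => // k; rewrite inE => /asboolP.
  move=> /existsNP[p /not_implyP[pp /not_implyP[pP /negP]]]; rewrite -ltNge => xp.
  have Np : (N <= p)%N by rewrite leqNgt -NE -leNgt ltW.
  have zk0 : z k != 0 by exact: (linear_form_neq0 alpha_nonpos iota_a be0 aE).
  have [|pi [pip piz pidp]] := ufd_prime_factor ufd ML M1 MM pp _ zk0 (esym (PE' (k : nat))) pP.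
    exact: linear_form_int.
  exists pi; split => // j pj; apply: val_inj => /=.
  exact: (prime_not_dvd_others pip pp Np (ltn_ord j) (ltn_ord k) pidp piz pj).
have [S [TS _ ->]] := Qdim_free_superset Tfree.
have arith (t s m p : nat) :
    (t <= s -> m <= p + k0 -> N <= t + m + 1 -> N <= s + p + k0.+1)%N by lia.
apply: arith (subset_leq_card TS) (card_smooth_args_le inj NE) _.
(* Outside [T] there are only smooth arguments and possibly the index 0, which accounts for the
   extra 1 in [k0.+1]. *)
rewrite -[X in (X <= _)%N]card_ord -(cardsC T) -addnA leq_add2l.
rewrite -(cardsID (smooth_args P x N) (~: T)); apply: leq_add; first exact/subset_leq_card/subsetIr.
rewrite -[X in (_ <= X)%N](size_iota 0) cardE -(size_map (@nat_of_ord N)); apply: uniq_leq_size.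
  by rewrite map_inj_uniq ?enum_uniq //; apply: val_inj.
move=> y /mapP[k]; rewrite mem_enum !inE => /andP[h /asboolPn/contrapT sm] ->.
by move: h; rewrite asboolT // andbT; case: (k : nat).
Qed.
End LowerBound.

(** * Asymptotics *)

Section Asymptotics.
Variable R : realType.
Implicit Types f : R -> R.

(** The hypothesis is one-sided, so f itself need not be o(x); its positive part is, and the two
    functions provided are that part and its opposite. *)
Lemma littleo_id_bounds f : (forall e, 0 < e -> \forall x \near +oo, f x <= e * x) ->
  exists e e' : {o_ +oo (@id R)}, forall x, f x <= e x /\ f x + e' x <= 0.
Proof.
move=> h; have o : forall eps : R, 0 < eps ->
    \forall x \near +oo, `|Num.max (f x) 0| <= eps * `|x|.
  move=> e e0; near=> x; have x0 : 0 <= x by near: x; exact: nbhs_pinfty_ge.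
  rewrite ger0_norm ?le_max ?lexx ?orbT // (ger0_norm x0) ge_max.
  apply/andP; split; last by rewrite mulr_ge0 // ltW.
  by near: x; exact: h.
have o' : forall eps : R, 0 < eps ->
    \forall x \near +oo, `|- Num.max (f x) 0| <= eps * `|x|.
  by move=> e /o; apply: filterS => x; rewrite normrN.
exists (Littleo (asboolT o)), (Littleo (asboolT o')) => x /=.
by rewrite subr_le0 !le_max !lexx.
Unshelve. all: by end_near.
Qed.

Lemma limf_einf_near f (B e : R) : limf_einf (fun x => (f x)%:E) +oo = B%:E -> 0 < e ->
  \forall x \near +oo, B - e <= f x.
Proof.
move=> fB e0; have : ((B - e)%:E < B%:E)%E by rewrite lte_fin; lra.
rewrite -fB limf_einfE => /ereal_sup_gt[_ [V VF <-] lt1].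
apply: filterS VF => x Vx; rewrite -lee_fin; apply: le_trans (ltW lt1) _.
by apply: ereal_inf_lbound; exists x.
Qed.

Lemma limf_esup_near f (U e : R) : limf_esup (fun x => (f x)%:E) +oo = U%:E -> 0 < e ->
  \forall x \near +oo, f x <= U + e.
Proof.
move=> fU e0; have : (U%:E < (U + e)%:E)%E by rewrite lte_fin; lra.
rewrite -fU limf_esupE => /ereal_inf_lt[_ [V VF <-] lt1].
apply: filterS VF => x Vx; rewrite -lee_fin; apply: le_trans (ltW lt1).
by apply: ereal_sup_ubound; exists x.
Qed.
End Asymptotics.

Theorem theorem5 (R : realType) (alpha : R[i])
    (alpha_alg : algebraicOver (ratr : rat -> R[i]) alpha)
    (alpha_nonpos : forall n : int, n <= 0 -> alpha <> n%:~R)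
    (K : fieldExtType rat) (iota : {rmorphism K -> R[i]})
    (a : K) (iota_a : iota a = alpha) (K_gen : <<1; a>>%VS = fullv)
    (beta gamma : K) (beta_int : OK K beta) (gamma_int : OK K gamma)
    (beta_neq0 : beta != 0) (a_frac : a = gamma / beta)
    (beta_gamma_coprime : OKcoprime beta gamma)
    (P : {poly int})
    (P_norm : forall n : int, (P.[n])%:~R = fieldNorm (n%:~R * beta + gamma)) :
  (forall B : R,
     limf_einf (fun x : R => ((Psi P x x)%:R / x)%:E) +oo = B%:E ->
     exists e : {o_ +oo (@id R)},
       \forall x \near +oo,
         (Qdim (logSpan alpha x))%:R <= (1 - B) * x + e x) /\
  (OKufd K ->
   forall U : R,
     limf_esup (fun x : R => ((Psi P x x)%:R / x)%:E) +oo = U%:E ->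
     exists e : {o_ +oo (@id R)},
       \forall x \near +oo,
         (1 - U) * x + e x <= (Qdim (logSpan alpha x))%:R).
Proof.
split=> [B BE|ufd U UE].
  pose f x : R := (Qdim (logSpan alpha x))%:R - (1 - B) * x.
  have [|e [e' eP]] := @littleo_id_bounds R f.
    move=> e e0.
    have [d ub] := upper_bound alpha_nonpos iota_a K_gen beta_int gamma_int beta_neq0 a_frac P_norm.
    (* This makes 2N/h <= (e/4) N. Another e/4 is lost in the lower limit, and the constants,
       including the gap N < x + 1, are absorbed in (e/2) x. *)
    have [h [h0 he]] : exists h : nat, 0 < h%:R :> R /\ 8 <= e * h%:R.
      exists (Num.truncn (8 / e)).+1; rewrite ltr0n; split => //.
      by rewrite mulrC -ler_pdivrMr //; apply/ltW/truncnS_gt.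
    have [N0 N0P] := ub h.
    have e4 : 0 < e / 4 by lra.
    near=> x; rewrite /f.
    have x0 : 0 < x by near: x; exact: nbhs_pinfty_gt.
    have xb : (1 + e / 4 + d%:R) * 2 <= e * x.
      by rewrite mulrC -ler_pdivrMl // mulrC; near: x; exact: nbhs_pinfty_ge.
    have xN0 : N0%:R <= x by near: x; exact: nbhs_pinfty_ge.
    have Bx : B - e / 4 <= (Psi P x x)%:R / x by near: x; exact: limf_einf_near BE e4.
    have [N [NE xN Nx]] := natural_below x0.
    have NN0 : (N0 <= N)%N by rewrite -(ler_nat R) (le_trans xN0).
    have := N0P x N NN0 NE xN.
    rewrite -(ler_nat R) !natrD !natrM => le1.
    rewrite ler_pdivlMr // in Bx.
    move: le1 Bx; move: (Psi P x x)%:R (Qdim _)%:R => p q le1 Bx.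
    have le2 : q + p <= N%:R + e / 4 * N%:R + d%:R.
      have pos : 0 <= (e * h%:R - 8) * N%:R by rewrite mulr_ge0 ?subr_ge0.
      by rewrite -(ler_pM2l h0); move: le1 pos; move: h%:R N%:R d%:R => h' N' d'; lra.
    have le3 : e / 4 * N%:R <= e / 4 * (x + 1) by rewrite ler_pM2l // ltW.
    by lra.
  by exists e; near=> x; have [+ _] := eP x; rewrite /f lerBlDl.
pose f x : R := (1 - U) * x - (Qdim (logSpan alpha x))%:R.
have [|e' [e eP]] := @littleo_id_bounds R f.
  move=> e e0.
  have [d lb] := lower_bound alpha_nonpos iota_a beta_int gamma_int beta_neq0 a_frac
    beta_gamma_coprime P_norm ufd.
  have e2 : 0 < e / 2 by lra.
  near=> x; rewrite /f.
  have x0 : 0 < x by near: x; exact: nbhs_pinfty_gt.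
  have xb : d%:R * 2 <= e * x.
    by rewrite mulrC -ler_pdivrMl // mulrC; near: x; exact: nbhs_pinfty_ge.
  have Ux : (Psi P x x)%:R / x <= U + e / 2 by near: x; exact: limf_esup_near UE e2.
  have [N [NE xN Nx]] := natural_below x0.
  have := lb x N NE xN; rewrite -(ler_nat R) !natrD => le1.
  rewrite ler_pdivrMr // in Ux.
  by lra.
by exists e; near=> x; have [_] := eP x; rewrite /f addrAC subr_le0.
Unshelve. all: by end_near.
Qed.
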